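(* Let $0<m<\infty$, let $\Omega\subset\mathbb{C}^m$ be open, and let $E,F$ be complex Banach spaces. Then every $\mathcal{O}$-homomorphism $\phi:\mathcal{O}^E\rightarrow\mathcal{O}^F$ of plain sheaves over $\Omega$ is plain, i.e., it is induced by a holomorphic map $\Phi:\Omega\rightarrow\mathrm{Hom}(E,F)$.
   Context: All Banach spaces are over $\mathbb{C}$. $\mathrm{Hom}(E,F)$ is the Banach space of continuous linear operators $E\to F$ with the operator norm. For a Banach space $E$, $\mathcal{O}^E$ denotes the sheaf over $\Omega$ of germs of $E$-valued holomorphic functions (a ''plain sheaf''), $\mathcal{O}=\mathcal{O}^{\mathbb{C}}$ is the sheaf of rings of germs of scalar holomorphic functions, and $\mathcal{O}^E$ is a sheaf of $\mathcal{O}$-modules. An $\mathcal{O}$-homomorphism is a homomorphism of sheaves of $\mathcal{O}$-modules (purely algebraic; no continuity is assumed). A holomorphic $\Phi:\Omega\to\mathrm{Hom}(E,F)$ induces an $\mathcal{O}$-homomorphism $\mathcal{O}^E\to\mathcal{O}^F$ that sends the germ at $\zeta$ of a holomorphic $e:U\to E$ ($U\subset\Omega$ open, $\zeta\in U$) to the germ at $\zeta$ of $z\mapsto\Phi(z)e(z)$; homomorphisms obtained in this way are called plain. *)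

(* Defs.v *)
From HB Require Import structures.
From mathcomp Require Import all_boot all_order all_algebra.
From mathcomp Require Import generic_quotient complex.
From mathcomp Require Import all_classical all_reals all_analysis.

Set Implicit Arguments.
Unset Strict Implicit.
Unset Printing Implicit Defensive.

Import Order.TTheory GRing.Theory Num.Theory.
Import numFieldNormedType.Exports.

Local Open Scope classical_set_scope.
Local Open Scope ring_scope.
Local Open Scope quotient_scope.

(* The max norm on C^m. *)
Definition Cn (R : realType) (m : nat) : normedModType R[i] := 'rV[R[i]]_m.

(* Differentiability is over the scalar field [R[i]] of the normed modules, so
   this is complex Frechet differentiability. It is only used with [U] open. *)
Definition holomorphic (R : realType) (V E : normedModType R[i]) (U : set V)
  (f : V -> E) := forall z, U z -> differentiable f z.

Section Germs.
Context {R : realType} {V : normedModType R[i]}.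

Definition holomorphic_near (E : normedModType R[i]) (z : V) : {pred V -> E} :=
  [pred f | `[< \forall w \near z, differentiable f w >]].
Arguments holomorphic_near : clear implicits.

Definition pregerm (E : normedModType R[i]) (z : V) : Type :=
  {f : V -> E | f \in holomorphic_near E z}.
HB.instance Definition _ E z := Choice.on (pregerm E z).

Section GermType.
Variables (E : normedModType R[i]) (z : V).

Definition eq_near (f g : pregerm E z) : bool :=
  `[< \forall w \near z, val f w = val g w >].

Lemma eq_near_refl : reflexive eq_near.
Proof. by move=> f; apply/asboolP; near=> w. Unshelve. all: by end_near. Qed.

Lemma eq_near_sym : symmetric eq_near.
Proof.
by move=> f g; apply/asboolP/asboolP; apply: filterS => w ->.
Qed.

Lemma eq_near_trans : transitive eq_near.
Proof.
move=> g f h /asboolP fg /asboolP gh; apply/asboolP.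
by apply: filterS2 fg gh => w -> ->.
Qed.

Canonical eq_near_equiv := EquivRel eq_near eq_near_refl eq_near_sym eq_near_trans.

Definition germ : Type := {eq_quot eq_near}.
HB.instance Definition _ := Choice.on germ.
HB.instance Definition _ := Quotient.on germ.

Lemma holomorphic_near_cst (a : E) : cst a \in holomorphic_near E z.
Proof.
by apply/asboolP; near=> w; exact: differentiable_cst.
Unshelve. all: by end_near. Qed.

(* The germ at [z] of [f]; a junk value when [f] is not holomorphic near [z]. *)
Definition germ_of (f : V -> E) : germ :=
  \pi_germ (insubd (Sub (cst 0) (holomorphic_near_cst 0) : pregerm E z) f).

Definition germ_repr (g : germ) : V -> E := val (repr g).

Lemma germ_repr_holo (g : germ) :
  \forall w \near z, differentiable (germ_repr g) w.
Proof. by have /asboolP := valP (repr g). Qed.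

Lemma germ_ofK (f : V -> E) : (\forall w \near z, differentiable f w) ->
  \forall w \near z, germ_repr (germ_of f) w = f w.
Proof.
move=> fz; rewrite /germ_repr /germ_of.
have /eqmodP/asboolP := reprK (\pi_germ (insubd
  (Sub (cst 0) (holomorphic_near_cst 0) : pregerm E z) f)).
by apply: filterS => w ->; rewrite insubdK //; exact/asboolP.
Qed.

Lemma germ_reprK (g : germ) : germ_of (germ_repr g) = g.
Proof. by rewrite /germ_of /germ_repr valKd reprK. Qed.

Lemma eq_germ (g h : germ) :
  (\forall w \near z, germ_repr g w = germ_repr h w) -> g = h.
Proof.
move=> gh; rewrite -[g]reprK -[h]reprK; apply/eqmodP; exact/asboolP.
Qed.

Lemma eq_germ_of (f g : V -> E) : (\forall w \near z, differentiable f w) ->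
  (\forall w \near z, differentiable g w) ->
  (germ_of f = germ_of g <-> \forall w \near z, f w = g w).
Proof.
move=> fz gz; have fK := germ_ofK fz; have gK := germ_ofK gz; split=> [e|fg].
  by move: fK; rewrite e => fK; apply: filterS2 fK gK => w <- <-.
by apply: eq_germ; apply: filterS3 fK gK fg => w -> -> ->.
Qed.

Definition germ_add (g h : germ) := germ_of (germ_repr g \+ germ_repr h).
Definition germ_opp (g : germ) := germ_of (\- germ_repr g).

Lemma germ_reprD (g h : germ) : \forall w \near z,
  germ_repr (germ_add g h) w = germ_repr g w + germ_repr h w.
Proof.
apply: germ_ofK; apply: filterS2 (germ_repr_holo g) (germ_repr_holo h) => w.
exact: differentiableD.
Qed.

Lemma germ_reprN (g : germ) : \forall w \near z,
  germ_repr (germ_opp g) w = - germ_repr g w.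
Proof.
apply: germ_ofK; apply: filterS (germ_repr_holo g) => w.
exact: differentiableN.
Qed.

Lemma germ_repr_cst (a : E) : \forall w \near z, germ_repr (germ_of (cst a)) w = a.
Proof. by apply: (@germ_ofK (cst a)); exact/asboolP/holomorphic_near_cst. Qed.

Lemma germ_addA : associative germ_add.
Proof.
move=> f g h; apply: eq_germ; near=> w.
rewrite (near (germ_reprD f (germ_add g h)) w)//.
rewrite (near (germ_reprD g h) w)//.
rewrite (near (germ_reprD (germ_add f g) h) w)//.
by rewrite (near (germ_reprD f g) w)// addrA.
Unshelve. all: by end_near. Qed.

Lemma germ_addC : commutative germ_add.
Proof.
move=> f g; apply: eq_germ; near=> w.
rewrite (near (germ_reprD f g) w)//.
by rewrite (near (germ_reprD g f) w)// addrC.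
Unshelve. all: by end_near. Qed.

Lemma germ_add0 : left_id (germ_of (cst 0)) germ_add.
Proof.
move=> f; apply: eq_germ; near=> w.
rewrite (near (germ_reprD (germ_of (cst 0)) f) w)//.
by rewrite (near (germ_repr_cst 0) w)// add0r.
Unshelve. all: by end_near. Qed.

Lemma germ_addN : left_inverse (germ_of (cst 0)) germ_opp germ_add.
Proof.
move=> f; apply: eq_germ; near=> w.
rewrite (near (germ_reprD (germ_opp f) f) w)//.
rewrite (near (germ_reprN f) w)//.
by rewrite (near (germ_repr_cst 0) w)// addNr.
Unshelve. all: by end_near. Qed.

HB.instance Definition _ :=
  GRing.isZmodule.Build germ germ_addA germ_addC germ_add0 germ_addN.

End GermType.

End Germs.

Section GermModule.
Context {R : realType} {V : normedModType R[i]}.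

Lemma differentiable_scale (E : normedModType R[i]) (a : V -> R[i]^o)
    (f : V -> E) (w : V) : differentiable a w -> differentiable f w ->
  differentiable (fun v => (a v : R[i]) *: f v) w.
Proof.
move=> aw fw.
have b : bilinear_for (GRing.Scale.Law.clone _ _ *:%R _)
  (GRing.Scale.Law.clone _ _ *:%R _) (fun (x : R[i]^o) (y : E) => (x : R[i]) *: y).
  split=> [u'|u] k x y /=; first by rewrite scalerDl scalerA.
  by rewrite scalerDr !scalerA mulrC.
pose m : {bilinear R[i]^o -> E -> E} := HB.pack
  (fun (x : R[i]^o) (y : E) => (x : R[i]) *: y)
  (bilinear_isBilinear.Build _ _ _ _ _ _ _ b).
apply: (@differentiable_comp _ _ _ _ (fun v => (a v, f v))
  (fun p : R[i]^o * E => m p.1 p.2)).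
  exact: differentiable_pair.
apply: differentiable_bilin; exact: scale_continuous.
Qed.

Variables (E : normedModType R[i]) (z : V).

Definition germ_ring : Type := germ R[i]^o z.
HB.instance Definition _ := GRing.Zmodule.on germ_ring.

Definition germ_scale (a : germ_ring) (f : germ E z) : germ E z :=
  germ_of z (fun w => (germ_repr a w : R[i]) *: germ_repr f w).

Lemma germ_reprZ (a : germ_ring) (f : germ E z) : \forall w \near z,
  germ_repr (germ_scale a f) w = (germ_repr a w : R[i]) *: germ_repr f w.
Proof.
apply: germ_ofK; apply: filterS2 (germ_repr_holo a) (germ_repr_holo f) => w.
exact: differentiable_scale.
Qed.
End GermModule.

Section GermRing.
Context {R : realType} {V : normedModType R[i]}.

Section Scale.
Variables (E : normedModType R[i]) (z : V).
Local Notation O := (germ_ring z).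

Lemma germ_scaleA (a b : O) (f : germ E z) :
  germ_scale a (germ_scale b f) =
  germ_scale (germ_scale a (b : germ R[i]^o z)) f.
Proof.
apply: eq_germ; near=> w.
rewrite (near (germ_reprZ a (germ_scale b f)) w)//.
rewrite (near (germ_reprZ b f) w)//.
rewrite (near (germ_reprZ (germ_scale a (b : germ R[i]^o z)) f) w)//.
by rewrite (near (germ_reprZ a (b : germ R[i]^o z)) w)// scalerA.
Unshelve. all: by end_near. Qed.

Lemma germ_scale1 : left_id (germ_of z (cst (1 : R[i]^o)) : O) (@germ_scale R V E z).
Proof.
move=> f; apply: eq_germ; near=> w.
rewrite (near (germ_reprZ (germ_of z (cst (1 : R[i]^o))) f) w)//.
by rewrite (near (germ_repr_cst z (1 : R[i]^o)) w)// scale1r.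
Unshelve. all: by end_near. Qed.

Lemma germ_scaleDr : right_distributive (@germ_scale R V E z) +%R.
Proof.
move=> a f g; apply: eq_germ; near=> w.
rewrite (near (germ_reprZ a (f + g)) w)//.
rewrite (near (germ_reprD f g) w)//.
rewrite (near (germ_reprD (germ_scale a f) (germ_scale a g)) w)//.
rewrite (near (germ_reprZ a f) w)//.
by rewrite (near (germ_reprZ a g) w)// scalerDr.
Unshelve. all: by end_near. Qed.

Lemma germ_scaleDl (f : germ E z) : {morph (@germ_scale R V E z)^~ f : a b / a + b}.
Proof.
move=> a b; apply: eq_germ; near=> w.
rewrite (near (germ_reprZ (a + b) f) w)//.
rewrite (near (germ_reprD a b) w)//.
rewrite (near (germ_reprD (germ_scale a f) (germ_scale b f)) w)//.
rewrite (near (germ_reprZ a f) w)//.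
by rewrite (near (germ_reprZ b f) w)// scalerDl.
Unshelve. all: by end_near. Qed.

End Scale.

Section Ring.
Variable z : V.
Local Notation O := (germ_ring z).

Definition germ_mul (a b : O) : O := germ_scale a (b : germ R[i]^o z).
Definition germ_one : O := germ_of z (cst (1 : R[i]^o)).

Lemma germ_mulA : associative germ_mul.
Proof. by move=> a b c; rewrite /germ_mul germ_scaleA. Qed.

Lemma germ_mulC : commutative germ_mul.
Proof.
move=> a b; apply: eq_germ; rewrite /germ_mul.
have ab := germ_reprZ a (b : germ R[i]^o z).
have ba := germ_reprZ b (a : germ R[i]^o z).
apply: filterS2 ab ba => w abw baw; apply: etrans abw _; apply: etrans (esym baw).
exact: (@mulrC R[i] (germ_repr a w) (germ_repr b w)).
Qed.

Lemma germ_mul1 : left_id germ_one germ_mul.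
Proof. exact: germ_scale1. Qed.

Lemma germ_mulDl : left_distributive germ_mul +%R.
Proof. by move=> a b c; apply: germ_scaleDl. Qed.

Lemma germ_one_neq0 : germ_one != 0.
Proof.
apply/eqP => e; have := nbhs_singleton (germ_repr_cst z (1 : R[i]^o)).
rewrite -/germ_one e (nbhs_singleton (germ_repr_cst z (0 : R[i]^o))).
by move/eqP; rewrite eq_sym oner_eq0.
Qed.

HB.instance Definition _ := GRing.Zmodule_isComNzRing.Build O
  germ_mulA germ_mulC germ_mul1 germ_mulDl germ_one_neq0.

End Ring.

HB.instance Definition _ (E : normedModType R[i]) (z : V) :=
  GRing.Zmodule_isLmodule.Build (germ_ring z) (germ E z)
    (@germ_scaleA E z) (@germ_scale1 E z) (@germ_scaleDr E z) (@germ_scaleDl E z).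

End GermRing.

Section Sheaf.
Context {R : realType} {V : normedModType R[i]}.
Variable Omega : set V.

Section Etale.
Variable E : normedModType R[i].

(* The sheaf over [Omega] of germs of holomorphic [E]-valued functions, as an
   etale space: the disjoint union of its stalks, topologized by the base of
   all sheets. *)
Record etale := Etale { base : Omega; stalk_germ : germ E (val base) }.
HB.instance Definition _ := gen_eqMixin etale.
HB.instance Definition _ := gen_choiceMixin etale.

Definition local_section : set (set V * (V -> E)) :=
  [set s | open s.1 /\ holomorphic s.1 s.2].

Definition sheet (s : set V * (V -> E)) : set etale :=
  [set p | s.1 (val (base p)) /\ stalk_germ p = germ_of (val (base p)) s.2].

Lemma open_holomorphic (U : set V) (f : V -> E) (z : V) :
  open U -> U z -> holomorphic U f -> \forall w \near z, differentiable f w.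
Proof. by move=> oU Uz hf; apply: filterS (open_nbhs_nbhs (conj oU Uz)). Qed.

Lemma sheet_cover : \bigcup_(s in local_section) sheet s = setT.
Proof.
rewrite -subTset => -[z g] _.
have := germ_repr_holo g; rewrite -nbhs_nearE nbhsE => -[U [oU Uz] hU].
exists (U, germ_repr g) => //=; split=> //=.
by rewrite germ_reprK.
Qed.

Lemma sheet_join s t p : local_section s -> local_section t ->
  sheet s p -> sheet t p ->
  exists u, [/\ local_section u, sheet u p & sheet u `<=` sheet s `&` sheet t].
Proof.
move: s t p => [U e] [W f] [z g] [/= oU he] [/= oW hf] [/= Uz ->] [/= Wz].
have ez := open_holomorphic oU Uz he; have fz := open_holomorphic oW Wz hf.
move=> /(eq_germ_of ez fz); rewrite -nbhs_nearE nbhsE => -[X [oX Xz] ef].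
exists (U `&` W `&` X, e); split.
- by split=> /=; [apply: openI => //; exact: openI|move=> w [[/he]]].
- by split.
move=> [w h] [/= [[Uw Ww] Xw] ->]; split; split => //=.
apply/eq_germ_of; [exact: open_holomorphic he|exact: open_holomorphic hf|].
exact: filterS ef (open_nbhs_nbhs (conj oX Xw)).
Qed.

HB.instance Definition _ :=
  isBaseTopological.Build etale sheet_cover sheet_join.

End Etale.

(* A homomorphism of sheaves of modules over the sheaf of rings of germs of
   scalar holomorphic functions, whose stalk at [z] is [germ_ring z]. *)
Record sheaf_hom (E F : normedModType R[i]) := SheafHom {
  stalk_hom :> forall z : Omega, {linear germ E (val z) -> germ F (val z)};
  stalk_hom_continuous : continuous
    (fun p : etale E => Etale (stalk_hom (base p) (stalk_germ p))) }.

End Sheaf.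

Section Hom.
Context {R : realType} {E F : normedModType R[i]}.

Definition continuous_linear : {pred E -> F} :=
  [pred f | `[< linear f /\ continuous f >]].

Definition Hom : Type := {f : E -> F | f \in continuous_linear}.

Lemma continuous_linear_submod : subsemimod_closed continuous_linear.
Proof.
apply: GRing.submod_closed_semi; split=> [|a f g /asboolP[lf cf] /asboolP[lg cg]].
  apply/asboolP; split=> [a x y|]; last exact: cst_continuous.
  by rewrite /= scaler0 addr0.
apply/asboolP; split=> [k x y|x]; last first.
  by apply: cvgD; [apply: cvgZl_tmp; exact: cf|exact: cg].
have E0 v : (a *: f + g) v = a *: f v + g v by [].
rewrite !E0 lf lg.
by rewrite !scalerDr !scalerA [a * k]mulrC addrACA.
Qed.

HB.instance Definition _ := [isSub of Hom for (@sval _ _)].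
HB.instance Definition _ := [Choice of Hom by <:].
HB.instance Definition _ :=
  GRing.SubChoice_isSubLmodule.Build _ _ _ Hom continuous_linear_submod.

Definition Hom_fun (f : Hom) : E -> F := val f.
Coercion Hom_fun : Hom >-> Funclass.

Lemma Hom_linear (f : Hom) : linear f.
Proof. by have /asboolP[] := valP f. Qed.

HB.instance Definition _ (f : Hom) :=
  GRing.isLinear.Build R[i] E F *:%R f (Hom_linear f).

Lemma Hom_continuous (f : Hom) : continuous f.
Proof. by have /asboolP[] := valP f. Qed.

Lemma HomD (f g : Hom) x : (f + g : Hom) x = f x + g x.
Proof. by rewrite /Hom_fun raddfD. Qed.

Lemma HomZ a (f : Hom) x : (a *: f : Hom) x = a *: f x.
Proof. by rewrite /Hom_fun linearZ. Qed.

(* Norms take values in [R[i]], so the supremum is taken over real parts. *)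
Definition opnorm (f : Hom) : R[i] :=
  (sup [set complex.Re `|f x| | x in [set x : E | `|x| <= 1]])%:C%C.

Lemma normRe (W : normedModType R[i]) (x : W) : `|x| = (complex.Re `|x|)%:C%C.
Proof.
have := normr_ge0 x; rewrite lecE => /andP[/eqP im _].
by apply/eqP; rewrite eq_complex /= im !eqxx.
Qed.

Lemma opnorm_has_sup (f : Hom) :
  has_sup [set complex.Re `|f x| | x in [set x : E | `|x| <= 1]].
Proof.
split; first by exists (complex.Re `|f 0|), 0 => //=; rewrite normr0.
have /linear_boundedP := continuous_linear_bounded 0 (@Hom_continuous f 0).
move=> /pinfty_ex_gt0[M M0 fM]; exists (complex.Re M) => _ [x /= x1 <-].
have : `|f x| <= M by rewrite (le_trans (fM x))// ler_piMr// ltW.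
by rewrite lecE => /andP[].
Qed.

Lemma opnorm_unit (f : Hom) x : `|x| <= 1 -> `|f x| <= opnorm f.
Proof.
move=> x1; rewrite normRe lecR; apply: sup_upper_bound (opnorm_has_sup f) _ _.
by exists x.
Qed.

Lemma opnorm_le (f : Hom) (M : R[i]) :
  (forall x, `|x| <= 1 -> `|f x| <= M) -> opnorm f <= M.
Proof.
move=> fM; have M0 : 0 <= M.
  by apply: le_trans (fM 0 _); rewrite ?normr_ge0// normr0.
rewrite lecE /=; move: (M0); rewrite lecE => /andP[-> _] /=.
apply: ge_sup; first by have [] := opnorm_has_sup f.
by move=> _ [x /= x1 <-]; have := fM x x1; rewrite lecE => /andP[].
Qed.

Lemma opnorm_ge0 (f : Hom) : 0 <= opnorm f.
Proof. by apply: le_trans (@opnorm_unit f 0 _); rewrite ?normr_ge0// normr0. Qed.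

Lemma opnormP (f : Hom) x : `|f x| <= opnorm f * `|x|.
Proof.
have [->|x0] := eqVneq x 0; first by rewrite linear0 !normr0 mulr0.
have nx : 0 < `|x| by rewrite normr_gt0.
rewrite -ler_pdivrMr// mulrC -[X in X * _]gtr0_norm ?invr_gt0//.
rewrite -normrZ -linearZ; apply: opnorm_unit.
by rewrite normrZ normfV normr_id mulVf// gt_eqF.
Qed.

Lemma opnormD (f g : Hom) : opnorm (f + g) <= opnorm f + opnorm g.
Proof.
apply: opnorm_le => x x1; rewrite HomD (le_trans (ler_normD _ _))//.
by rewrite lerD// opnorm_unit.
Qed.

Lemma opnormZ a (f : Hom) : opnorm (a *: f) = `|a| * opnorm f.
Proof.
have le b (g : Hom) : opnorm (b *: g) <= `|b| * opnorm g.
  apply: opnorm_le => x x1; rewrite HomZ normrZ ler_wpM2l//.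
  exact: opnorm_unit.
apply/eqP; rewrite eq_le le /=; have [->|a0] := eqVneq a 0.
  by rewrite normr0 mul0r opnorm_ge0.
rewrite -[in leLHS](scalerK a0 f) -ler_pdivlMl ?normr_gt0//.
by rewrite -normfV le.
Qed.

Lemma opnorm0_eq0 (f : Hom) : opnorm f = 0 -> f = 0.
Proof.
move=> f0; apply/val_inj/funext => x; apply/eqP; rewrite -normr_le0.
by have := opnormP f x; rewrite f0 mul0r.
Qed.

HB.instance Definition _ :=
  @Lmodule_isNormed.Build R[i] Hom opnorm opnormD opnormZ opnorm0_eq0.

Lemma Hom_eval_continuous : continuous (fun p : Hom * E => p.1 p.2).
Proof.
move=> [f x]; apply/cvgrPdist_lt => e e0 /=.
have e2 : 0 < e / 2 by rewrite divr_gt0.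
have x1 : 0 < `|x| + 1 by rewrite ltr_wpDl.
have d0 : 0 < e / 2 / (`|x| + 1) by rewrite divr_gt0.
have c1 : (fun p : Hom * E => p.1) @ (f, x) --> f by exact: cvg_fst.
have c2 : (fun p : Hom * E => p.2) @ (f, x) --> x by exact: cvg_snd.
have c3 : (fun p : Hom * E => (f : Hom) p.2) @ (f, x) --> (f : Hom) x.
  by apply: (cvg_comp _ _ c2); exact: Hom_continuous.
move/cvgrPdist_lt : c1 => /(_ _ d0) n1; move/cvgrPdist_lt : c2 => /(_ _ ltr01) n2.
move/cvgrPdist_lt : c3 => /(_ _ e2) n3.
apply: filterS3 n1 n2 n3 => -[g y] /= fg xy fxy.
have -> : (f : Hom) x - (g : Hom) y = ((f : Hom) x - (f : Hom) y) + (f - g : Hom) y.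
  by rewrite /Hom_fun raddfB /= addrA subrK.
rewrite (le_lt_trans (ler_normD _ _))// [ltRHS]splitr ltrD//.
rewrite (le_lt_trans (opnormP _ _))//.
have yx : `|y| < `|x| + 1.
  rewrite -[y](subKr x) (le_lt_trans (ler_normB _ _))//.
  by rewrite ltrD2l.
rewrite (@le_lt_trans _ _ (opnorm (f - g) * (`|x| + 1)))//.
  by rewrite ler_wpM2l ?opnorm_ge0// ltW.
by rewrite -ltr_pdivlMr.
Qed.

End Hom.
Arguments Hom {R} E F.

Section Plain.
Context {R : realType} {V E F : normedModType R[i]}.

Lemma differentiable_Hom (Phi : V -> Hom E F) (e : V -> E) (w : V) :
  differentiable Phi w -> differentiable e w ->
  differentiable (fun v => Phi v (e v)) w.
Proof.
move=> Phiw ew.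
have b : bilinear_for (GRing.Scale.Law.clone _ _ *:%R _)
  (GRing.Scale.Law.clone _ _ *:%R _) (fun (f : Hom E F) (x : E) => f x).
  split=> [x|f] k y z /=; first by rewrite HomD HomZ.
  by rewrite linearP.
pose m : {bilinear Hom E F -> E -> F} := HB.pack
  (fun (f : Hom E F) (x : E) => f x) (bilinear_isBilinear.Build _ _ _ _ _ _ _ b).
apply: (@differentiable_comp _ _ _ _ (fun v => (Phi v, e v))
  (fun p : Hom E F * E => m p.1 p.2)).
  exact: differentiable_pair.
apply: (@differentiable_bilin _ _ _ _ m); exact: Hom_eval_continuous.
Qed.

Lemma holomorphic_Hom (U : set V) (Phi : V -> Hom E F) (e : V -> E) :
  holomorphic U Phi -> holomorphic U e -> holomorphic U (fun v => Phi v (e v)).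
Proof.
by move=> hPhi he z Uz; apply: differentiable_Hom; [exact: hPhi|exact: he].
Qed.

Variable Omega : set V.

Definition induced_by (phi : sheaf_hom Omega E F) (Phi : V -> Hom E F) :=
  forall (z : Omega) (U : set V) (e : V -> E),
    open U -> U `<=` Omega -> U (val z) -> holomorphic U e ->
    phi z (germ_of (val z) e) = germ_of (val z) (fun w => Phi w (e w)).

(* Only the values of [Phi] on [Omega] matter. *)
Definition plain (phi : sheaf_hom Omega E F) :=
  exists2 Phi : V -> Hom E F, holomorphic Omega Phi & induced_by phi Phi.

End Plain.

(* Main.v *)
Require Import Defs.
From HB Require Import structures.
From mathcomp Require Import all_boot all_order all_algebra.
From mathcomp Require Import complex ring lra.
From mathcomp Require Import all_classical all_reals all_analysis.
Set Implicit Arguments.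
Unset Strict Implicit.
Unset Printing Implicit Defensive.
Import Order.TTheory GRing.Theory Num.Theory.
Import numFieldNormedType.Exports.
Local Open Scope ring_scope.
Local Open Scope classical_set_scope.

(* Let T w x be the value at w of the image under phi of the germ of the
   constant section x.  By Hadamard's lemma f - f w lies in the maximal ideal
   times the stalk, so linearity over the germs of scalar functions forces
   phi f to have the value T w (f w) at every w; in particular w |-> T w (f w)
   is holomorphic whenever f is.

   No continuity of T w is given.  If T were unbounded near z0, one could choose
   points z_n tending to z0 and small vectors x_n inductively so that the Newton
   series f = sum_n p_n x_n, where the polynomial p_n vanishes at z_0, ...,
   z_{n-1}, converges to a holomorphic f with |T z_n (f z_n)| >= n,
   contradicting the continuity of w |-> T w (f w).  So T is bounded on a
   punctured neighborhood of z0, and by continuity of w |-> T w x also at z0.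
   A locally bounded, pointwise holomorphic family of operators is holomorphic
   in norm by second-order Cauchy estimates.

   Since holomorphy means mere complex differentiability, the Cauchy estimates
   rest on Goursat's theorem, proved on rectangles with a dyadic integral.
   Along complex lines they give a bound on f (z + h) - f z - Df z h that is
   quadratic in h and uniform in f, from which closure under uniform limits and
   Hadamard's lemma follow. *)

(** * Real-valued norms and derivatives *)

(** The obstacle is that [phi] is purely algebraic: no fibre map [T w] is known to be bounded, so
    the uniform boundedness principle does not apply to the family. A gliding hump normally controls
    the tail of its series by the bound of the operator at hand. Here interpolation does this
    instead: all later terms vanish at the earlier points, so that [T z_n] only ever meets a finite
    sum.

    The points have to stay away from [z0], since a factor vanishing at [z0] would destroy the lower
    bound of the polynomials near [z0]. This is why a punctured ball comes first, and why the
    dimension must be positive when the bound is carried over to [z0]: the centre has to be a limit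
    of other points.

    Integrals are taken only over segments, and only linearity, the sup bound, halving, and recovery
    of an antiderivative with quadratic remainder are used. Recursive dyadic sums give each of these
    by induction, with values in any Banach space. *)

Section RealNorm.
Context {R : realType}.

(* Norms in modules over [R[i]] take values in [R[i]]; [nrm] is real-valued. *)
Definition nrm {V : normedZmodType R[i]} (x : V) : R := complex.Re `|x|.

Lemma nrmE (V : normedZmodType R[i]) (x : V) : `|x| = (nrm x)%:C%C.
Proof.
have := normr_ge0 x; rewrite lecE => /andP[/eqP im _].
by apply/eqP; rewrite eq_complex /= im !eqxx.
Qed.

Lemma nrm_ge0 (V : normedZmodType R[i]) (x : V) : 0 <= nrm x.
Proof. by rewrite -lecR -nrmE normr_ge0. Qed.

Lemma nrm0 (V : normedZmodType R[i]) : nrm (0 : V) = 0.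
Proof. by apply/complexI; rewrite -nrmE normr0. Qed.

Lemma nrm_eq0 (V : normedZmodType R[i]) (x : V) : (nrm x == 0) = (x == 0).
Proof. by rewrite -[RHS]normr_eq0 nrmE eq_complex eqxx andbT. Qed.

Lemma nrm_gt0 (V : normedZmodType R[i]) (x : V) : (0 < nrm x) = (x != 0).
Proof. by rewrite lt_def nrm_ge0 andbT nrm_eq0. Qed.

Lemma nrm_le0 (V : normedZmodType R[i]) (x : V) : nrm x <= 0 -> x = 0.
Proof. by move=> x0; apply/eqP; rewrite -nrm_eq0 eq_le x0 nrm_ge0. Qed.

Lemma nrmN (V : normedZmodType R[i]) (x : V) : nrm (- x) = nrm x.
Proof. by rewrite /nrm normrN. Qed.

Lemma nrmD (V : normedZmodType R[i]) (x y : V) : nrm (x + y) <= nrm x + nrm y.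
Proof. by rewrite -lecR rmorphD /= -!nrmE ler_normD. Qed.

Lemma nrmB (V : normedZmodType R[i]) (x y : V) : nrm (x - y) <= nrm x + nrm y.
Proof. by rewrite (le_trans (nrmD _ _))// nrmN. Qed.

Lemma nrm_distC (V : normedZmodType R[i]) (x y : V) : nrm (x - y) = nrm (y - x).
Proof. by rewrite -opprB nrmN. Qed.

Lemma nrm_tri (V : normedZmodType R[i]) (y x z : V) :
  nrm (x - z) <= nrm (x - y) + nrm (y - z).
Proof. by rewrite -[x - z](subrKA y) nrmD. Qed.

Lemma nrmZ (V : normedModType R[i]) (a : R[i]) (x : V) :
  nrm (a *: x) = nrm a * nrm x.
Proof. by apply/complexI; rewrite rmorphM /= -!nrmE normrZ. Qed.

Lemma nrmM (a b : R[i]) : nrm (a * b) = nrm a * nrm b.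
Proof. by apply/complexI; rewrite rmorphM /= -!nrmE normrM. Qed.

Lemma nrmV (a : R[i]) : nrm a^-1 = (nrm a)^-1.
Proof. by apply/complexI; rewrite fmorphV /= -!nrmE normfV. Qed.

Lemma nrmC (a : R) : nrm (a%:C%C : R[i]) = `|a|.
Proof. by rewrite /nrm normc_def /= expr0n addr0 sqrtr_sqr. Qed.

Lemma nrm1 : nrm (1 : R[i]) = 1.
Proof. by rewrite -[1]/(1%:C%C) nrmC normr1. Qed.

Lemma nrm_Re (z : R[i]) : `|complex.Re z| <= nrm z.
Proof. by rewrite -lecR -nrmE normc_ge_Re. Qed.

Lemma nrm_complex (a b : R) : nrm (Complex a b) <= `|a| + `|b|.
Proof.
rewrite (complexE (Complex a b)) /= (le_trans (nrmD _ _))// nrmM !nrmC.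
by rewrite lerD2l /nrm normc_def /= expr0n expr1n add0r sqrtr1 mul1r.
Qed.

Lemma nrm_nearP (V : normedModType R[i]) (z : V) (P : V -> Prop) :
  (\forall w \near z, P w) <->
  exists2 d : R, 0 < d & forall h, nrm h < d -> P (z + h).
Proof.
split=> [/nbhs_normP[e /= e0 eP]|[d d0 dP]].
  exists (complex.Re e); first by move: e0; rewrite ltcE => /andP[].
  move=> h hd; apply: eP; rewrite /= opprD addNKr normrN nrmE.
  by move: e0; rewrite !ltcE /= => /andP[/eqP -> _]; rewrite eqxx hd.
apply/nbhs_normP; exists d%:C%C; rewrite /= ?ltcR// => y /=.
by rewrite nrmE ltcR nrm_distC => /dP; rewrite subrKC.
Qed.

Lemma complete_nrm (F : completeNormedModType R[i]) (u : nat -> F) :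
  (forall e : R, 0 < e -> exists n0, forall n p, (n0 <= n)%N -> (n0 <= p)%N ->
    nrm (u n - u p) <= e) ->
  exists l, forall e : R, 0 < e -> exists n0, forall n, (n0 <= n)%N ->
    nrm (u n - l) <= e.
Proof.
move=> cu; have : cvg (u @ \oo).
  apply/cauchy_cvgP/cauchy_exP => e e0.
  have re0 : 0 < complex.Re e by move: e0; rewrite ltcE => /andP[].
  have [n0 n0P] := cu _ (divr_gt0 re0 (ltr0Sn _ 1)).
  exists (u n0); exists n0 => // n /= n0n; rewrite -ball_normE /= nrmE.
  move: e0; rewrite !ltcE /= => /andP[/eqP -> _]; rewrite eqxx /=.
  by apply: (le_lt_trans (n0P n0 n (leqnn _) n0n)); rewrite ltr_pdivrMr//; lra.
move=> /cvg_ex[l /cvgrPdist_lt ul]; exists l => e e0.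
have [|n0 _ n0P] := ul e%:C%C; first by rewrite ltcR.
by exists n0 => n /n0P /=; rewrite nrmE ltcR nrm_distC => /ltW.
Qed.

Lemma le_eps (x y : R) : (forall e : R, 0 < e -> x <= y + e) -> x <= y.
Proof. by move=> xy; apply/ler_addgt0Pr => e e0; exact: xy. Qed.

(** Neither linearity nor boundedness of [L] is built in. They are supplied separately, so that a
    candidate derivative obtained as a pointwise limit can be tested directly. *)
Definition deriv_at (V W : normedModType R[i]) (f : V -> W) (z : V) (L : V -> W) :=
  forall e : R, 0 < e -> exists2 d : R, 0 < d &
    forall h, nrm h < d -> nrm (f (z + h) - f z - L h) <= e * nrm h.

Lemma differentiable_deriv (V W : normedModType R[i]) (f : V -> W) (z : V) :
  differentiable f z -> deriv_at f z ('d f z).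
Proof.
move=> /diff_locally/eqaddoP H e e0.
have : 0 < e%:C%C :> R[i] by rewrite ltcR.
move=> /H; rewrite near_simpl => /nrm_nearP[d d0 dP]; exists d => // h /dP.
rewrite add0r !nrmE -rmorphM lecR /=.
have -> : (f \o shift z - (cst (f z) + 'd f z)) h = f (z + h) - f z - 'd f z h.
  by rewrite opprD addrA -[LHS]/(f (h + z) - f z - 'd f z h) addrC (addrC h z) addrC.
by [].
Qed.

Lemma diff_bounded (V W : normedModType R[i]) (f : V -> W) (z : V) :
  differentiable f z -> exists2 K, 0 <= K & forall h, nrm ('d f z h) <= K * nrm h.
Proof.
move=> /(@diff_continuous _ _ _ _ _)/linear_bounded_continuous/linear_boundedP.
move=> /pinfty_ex_gt0[M M0 H]; exists (complex.Re M).
  by move: M0; rewrite ltcE => /andP[_ /ltW].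
move=> h; have := H h; move: M0; rewrite ltcE => /andP[/eqP M0 _].
by rewrite [M]complexE M0 !nrmE mulr0 addr0 /= -rmorphM lecR.
Qed.

Lemma deriv_differentiable (V W : normedModType R[i]) (f : V -> W) (z : V)
    (L : V -> W) (K : R) : linear L -> (forall h, nrm (L h) <= K * nrm h) ->
  deriv_at f z L -> differentiable f z.
Proof.
move=> lL bL dL.
pose l : {linear V -> W} := HB.pack L (GRing.isLinear.Build _ _ _ _ L lL).
have cl : continuous l.
  apply/linear_bounded_continuous/linear_boundedP; near=> r => x /=.
  rewrite (@le_trans _ _ (K%:C%C * `|x|))//.
    by rewrite !nrmE -rmorphM lecR bL.
  rewrite ler_wpM2r// ; near: r; apply: nbhs_pinfty_ge.
  by apply/complex_realP; exists K.
have ol : f \o shift z = cst (f z) + l +o_ 0 id.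
  apply/eqaddoP => e e0; have re0 : 0 < complex.Re e by move: e0; rewrite ltcE => /andP[].
  rewrite near_simpl; apply/nrm_nearP.
  have [d d0 dP] := dL _ re0; exists d => // h /dP; rewrite add0r.
  have -> : (f \o shift z - (cst (f z) + l)) h = f (z + h) - f z - L h.
    by rewrite opprD addrA -[LHS]/(f (h + z) - f z - L h) (addrC h z).
  move: e0; rewrite ltcE => /andP[/eqP ie _].
  by rewrite [e]complexE ie mulr0 addr0 !nrmE -rmorphM lecR.
by apply/diff_locallyP; rewrite (diff_unique cl ol).
Unshelve. all: by end_near. Qed.

Lemma deriv_at_line (V W : normedModType R[i]) (f : V -> W) (z k : V) (a : R[i])
    (L : V -> W) :
  scalable L -> deriv_at f (z + a *: k) L ->
  deriv_at (fun b : R[i]^o => f (z + b *: k)) a (fun b : R[i]^o => b *: L k).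
Proof.
move=> lL dL e e0.
(* The [+ 1] keeps the denominator positive when [k = 0]; the same device recurs below. *)
have k1 : 0 < nrm k + 1 by rewrite ltr_wpDl ?nrm_ge0.
have [d d0 dP] := dL _ (divr_gt0 e0 k1).
exists (d / (nrm k + 1)) => [|h hd]; first exact: divr_gt0.
rewrite scalerDl addrA -lL; apply: (le_trans (dP _ _)); rewrite nrmZ.
  rewrite (@le_lt_trans _ _ (nrm h * (nrm k + 1)))//.
    by rewrite ler_wpM2l ?nrm_ge0// lerDl.
  by rewrite -ltr_pdivlMr.
rewrite mulrCA mulrC ler_wpM2r ?nrm_ge0//.
by rewrite mulrAC ler_pdivrMr// ler_wpM2l ?ltW// ltrDl.
Qed.

Lemma deriv_at_unique (V W : normedModType R[i]) (f : V -> W) (z : V)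
    (L L' : V -> W) : scalable L -> scalable L' ->
  deriv_at f z L -> deriv_at f z L' -> L =1 L'.
Proof.
move=> sL sL' dL dL' h; apply/subr0_eq/nrm_le0/le_eps => e e0; rewrite add0r.
have h1 : 0 < nrm h + 1 by rewrite ltr_wpDl ?nrm_ge0.
have e1 : 0 < e / (nrm h + 1) / 2 by rewrite !divr_gt0.
have [d d0 dP] := dL _ e1; have [d' d'0 d'P] := dL' _ e1.
(* Both maps are compared at [t h] with [t] real and small; homogeneity then divides the error by
   [t]. *)
pose t := Num.min d d' / (nrm h + 1) / 2.
have t0 : 0 < t by rewrite !divr_gt0// lt_min d0.
have th : nrm (t%:C%C *: h) < Num.min d d'.
  rewrite nrmZ nrmC gtr0_norm// /t mulrAC ltr_pdivrMr// mulrAC ltr_pdivrMr//.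
  rewrite -mulrA ltr_pM2l ?lt_min ?d0//; have := nrm_ge0 h; lra.
move: th; rewrite lt_min => /andP[/dP k1 /d'P k2].
have : nrm (t%:C%C *: (L h - L' h)) <= e / (nrm h + 1) * (t * nrm h).
  rewrite scalerBr -sL -sL'; rewrite nrmZ nrmC gtr0_norm// in k1 k2.
  set A := f (z + _) - f z in k1 k2.
  have -> : L (t%:C%C *: h) - L' (t%:C%C *: h) =
    (A - L' (t%:C%C *: h)) - (A - L (t%:C%C *: h)).
    by rewrite opprB [RHS]addrC addrA subrK.
  rewrite (le_trans (nrmB _ _))// (le_trans (lerD k2 k1))// le_eqVlt.
  by apply/orP; left; apply/eqP; field; lra.
rewrite nrmZ nrmC gtr0_norm// mulrCA ler_pM2l// => /le_trans; apply.
by rewrite mulrAC ler_pdivrMr// ler_wpM2l ?ltW// ltrDl.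
Qed.

Lemma deriv_at_continuous (V W : normedModType R[i]) (f : V -> W) (z : V)
    (L : V -> W) K : (forall h, nrm (L h) <= K * nrm h) -> deriv_at f z L ->
  forall e : R, 0 < e -> exists2 d : R, 0 < d &
    forall h, nrm h < d -> nrm (f (z + h) - f z) <= e.
Proof.
move=> bL dL e e0; have [d d0 dP] := dL 1 ltr01.
have K1 : 0 < `|K| + 1 by rewrite ltr_wpDl.
exists (Num.min d (e / (`|K| + 1))) => [|h].
  by rewrite lt_min d0 divr_gt0.
rewrite lt_min ltr_pdivlMr// => /andP[/dP hd he].
rewrite -[f (z + h) - f z](subrK (L h)) (le_trans (nrmD _ _))//.
rewrite (le_trans (lerD hd (bL h)))// (le_trans _ (ltW he))//.
by rewrite mulrDr mulr1 mul1r addrC lerD2r mulrC ler_wpM2l ?nrm_ge0// ler_norm.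
Qed.

End RealNorm.

(** * Bisection arguments on intervals and rectangles *)

Section Bisection.
Context {R : realType}.

Lemma half_pow_small (x d : R) : 0 < d ->
  exists n0, forall n, (n0 <= n)%N -> x * 2^-1 ^+ n < d.
Proof.
move=> d0; exists (Num.bound (x / d)) => n n0n.
rewrite exprVn ltr_pdivrMr ?exprn_gt0// mulrC -ltr_pdivrMr//.
have [x0|x0] := leP x 0.
  by rewrite (@le_lt_trans _ _ 0) ?exprn_gt0// pmulr_lle0 ?invr_gt0.
rewrite (le_lt_trans (ltW (archi_boundP _))) ?divr_ge0 ?ltW//.
have -> : 2 ^+ n = (2 ^ n)%N%:R :> R by rewrite natrX.
by rewrite ltr_nat (leq_ltn_trans n0n)// ltn_expl.
Qed.

Lemma nested_intervals (a b : nat -> R) : (forall n, a n <= b n) ->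
  (forall n, a n <= a n.+1) -> (forall n, b n.+1 <= b n) ->
  exists x, forall n, a n <= x <= b n.
Proof.
move=> ab a1 b1.
have am i j : (i <= j)%N -> a i <= a j.
  by apply: (@homo_leq _ _ (fun x y => x <= y)) => // x y z; exact: le_trans.
have bm i j : (i <= j)%N -> b j <= b i.
  by apply: (@homo_leq _ _ (fun x y => y <= x)) => // x y z xy yz; exact: le_trans yz xy.
have a_le_b i j : a i <= b j.
  apply: (le_trans (am _ _ (leq_maxl i j))); apply: (le_trans (ab _)).
  exact: bm (leq_maxr i j).
have hs : has_sup (range a).
  by split; [exists (a 0%N), 0%N|exists (b 0%N) => _ [i _ <-]].
exists (sup (range a)) => n; apply/andP; split.
  by apply: (sup_upper_bound hs); exists n.
by apply: ge_sup => [|_ [i _ <-]]//; exists (a 0%N), 0%N.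
Qed.

(* A two-dimensional Cousin lemma. *)
Lemma quadrisection (P : R -> R -> R -> R -> Prop) (a b c d : R) :
  a <= b -> c <= d ->
  (forall a b c d m k : R, a <= b -> c <= d -> m = (a + b) / 2 -> k = (c + d) / 2 ->
    P a m c k -> P m b c k -> P a m k d -> P m b k d -> P a b c d) ->
  (forall x y : R, a <= x <= b -> c <= y <= d -> exists2 e : R, 0 < e &
    forall a' b' c' d' : R, a <= a' -> a' <= x <= b' -> b' <= b ->
      c <= c' -> c' <= y <= d' -> d' <= d -> b' - a' < e -> d' - c' < e ->
      P a' b' c' d') ->
  P a b c d.
Proof.
move=> ab cd glue loc; apply: contrapT => nP.
pose inv (q : R * R * R * R) := let: (a, b, c, d) := q in
  [/\ a <= b, c <= d & ~ P a b c d].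
pose child (q q' : R * R * R * R) := let: (a, b, c, d) := q in
  let: (a', b', c', d') := q' in
  [/\ a <= a', b' <= b & b' - a' = (b - a) * 2^-1] /\
  [/\ c <= c', d' <= d & d' - c' = (d - c) * 2^-1].
(* By [glue], a failing rectangle has a failing quarter. Iterating the choice gives nested failing
   rectangles, and their common point contradicts [loc]. *)
have step q : exists q', inv q -> inv q' /\ child q q'.
  case: (pselect (inv q)) => [iq|ni]; last by exists q.
  case: q iq => [[[a' b'] c'] d'] [ab' cd' nP'].
  pose m := (a' + b') / 2; pose k := (c' + d') / 2.
  have [p1|p1] := pselect (P a' m c' k); last first.
    by exists (a', m, c', k) => _; rewrite /inv /child /m /k; do !split => //; lra.
  have [p2|p2] := pselect (P m b' c' k); last first.
    by exists (m, b', c', k) => _; rewrite /inv /child /m /k; do !split => //; lra.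
  have [p3|p3] := pselect (P a' m k d'); last first.
    by exists (a', m, k, d') => _; rewrite /inv /child /m /k; do !split => //; lra.
  have [p4|p4] := pselect (P m b' k d'); last first.
    by exists (m, b', k, d') => _; rewrite /inv /child /m /k; do !split => //; lra.
  by case: nP'; exact: (glue _ _ _ _ m k).
have [f fP] := choice step.
pose q n := iter n f (a, b, c, d).
have iq n : inv (q n).
  by elim: n => [|n IH]; [split|case: (fP _ IH)].
have cq n : child (q n) (q n.+1) by have [] := fP _ (iq n).
pose A n := (q n).1.1.1; pose B n := (q n).1.1.2.
pose C n := (q n).1.2; pose D n := (q n).2.
have qE n : q n = (A n, B n, C n, D n) by rewrite /A /B /C /D; case: (q n) => [[[]]].
have cE n : [/\ A n <= A n.+1, B n.+1 <= B n & B n.+1 - A n.+1 = (B n - A n) * 2^-1] /\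
  [/\ C n <= C n.+1, D n.+1 <= D n & D n.+1 - C n.+1 = (D n - C n) * 2^-1].
  by have := cq n; rewrite !qE.
have iE n : [/\ A n <= B n, C n <= D n & ~ P (A n) (B n) (C n) (D n)].
  by have := iq n; rewrite qE.
have [x xAB] : exists x, forall n, A n <= x <= B n.
  by apply: nested_intervals => n; [case: (iE n)|case: (cE n) => -[]|case: (cE n) => -[]].
have [y yCD] : exists y, forall n, C n <= y <= D n.
  by apply: nested_intervals => n; [case: (iE n)|case: (cE n) => _ []|case: (cE n) => _ []].
have [e e0 eP] := loc x y (xAB 0%N) (yCD 0%N).
have [n1 n1P] := half_pow_small (b - a) e0; have [n2 n2P] := half_pow_small (d - c) e0.
pose n := maxn n1 n2.
have BA p : B p - A p = (b - a) * 2^-1 ^+ p.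
  elim: p => [|p IH]; first by rewrite expr0 mulr1.
  by rewrite exprSr mulrA -IH; case: (cE p) => -[].
have DC p : D p - C p = (d - c) * 2^-1 ^+ p.
  elim: p => [|p IH]; first by rewrite expr0 mulr1.
  by rewrite exprSr mulrA -IH; case: (cE p) => _ [].
have mono p : [/\ a <= A p, B p <= b, c <= C p & D p <= d].
  elim: p => [|p [? ? ? ?]]; first by split; rewrite ?lexx.
  by case: (cE p) => -[? ? _] [? ? _]; split; lra.
have [? ? ? ?] := mono n; case: (iE n) => _ _; apply; apply: eP => //.
  by rewrite BA n1P// leq_maxl.
by rewrite DC n2P// leq_maxr.
Qed.

(** The case of [quadrisection] in which the second interval is the point [0]. *)
Lemma bisection (P : R -> R -> Prop) (a b : R) : a <= b ->
  (forall a b m : R, a <= b -> m = (a + b) / 2 -> P a m -> P m b -> P a b) ->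
  (forall x : R, a <= x <= b -> exists2 e : R, 0 < e &
    forall a' b' : R, a <= a' -> a' <= x <= b' -> b' <= b -> b' - a' < e -> P a' b') ->
  P a b.
Proof.
move=> ab glue loc.
apply: (@quadrisection (fun a b _ _ => P a b) a b 0 0) => //.
  by move=> a' b' c' d' m k ab' _ mE _ P1 P2 _ _; exact: glue ab' mE P1 P2.
move=> x y /loc[e e0 eP] _; exists e => // a' b' c' d' ? ? ? _ _ _ ? _; exact: eP.
Qed.

End Bisection.

(** * Dyadic integration *)

Section DyadicIntegral.
Context {R : realType}.

Section NormedSpace.
Context {F : normedModType R[i]}.
Implicit Types (g : R -> F) (v : F).

Definition left_half g : R -> F := fun t => g (t / 2).
Definition right_half g : R -> F := fun t => g ((t + 1) / 2).

(** The left Riemann sum on [[0, 1]] with [2 ^ n] equal steps. The recursion on halves turns each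
    estimate into an induction on [n]. *)
Fixpoint dyadic_sum n g : F := if n is p.+1 then
  2^-1 *: (dyadic_sum p (left_half g) + dyadic_sum p (right_half g)) else g 0.

Lemma dyadic_sumD n g h : dyadic_sum n (g \+ h) = dyadic_sum n g + dyadic_sum n h.
Proof.
elim: n g h => [//|n IH] g h /=; rewrite -scalerDr; congr (_ *: _).
by rewrite addrACA -!IH.
Qed.

Lemma dyadic_sumZ n a g : dyadic_sum n (fun t => a *: g t) = a *: dyadic_sum n g.
Proof.
elim: n g => [//|n IH] g /=; rewrite scalerA mulrC -scalerA; congr (_ *: _).
by rewrite scalerDr -!IH.
Qed.

Lemma nrm_half : nrm (2^-1 : R[i]) = 2^-1.
Proof. by rewrite nrmV -[2](rmorph_nat (real_complex R)) nrmC ger0_norm. Qed.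

Lemma dyadic_sum_bound n g M : (forall t : R, 0 <= t <= 1 -> nrm (g t) <= M) ->
  nrm (dyadic_sum n g) <= M.
Proof.
elim: n g => [|n IH] g gM /=; first by apply: gM; lra.
rewrite nrmZ nrm_half mulrC ler_pdivrMr// mulr_natr mulr2n.
rewrite (le_trans (nrmD _ _))// lerD// IH// => t t01; apply: gM; lra.
Qed.

Definition oscillation g n (e : R) := forall s t : R, 0 <= s <= 1 -> 0 <= t <= 1 ->
  `|s - t| <= 2^-1 ^+ n -> nrm (g s - g t) <= e.

Lemma oscillation_half g n e : oscillation g n.+1 e ->
  oscillation (left_half g) n e /\ oscillation (right_half g) n e.
Proof.
move=> og; split=> s t s01 t01 st; apply: og; try lra.
  by rewrite -mulrBl normrM [`|2^-1|]ger0_norm// exprSr ler_pM2r.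
by rewrite -mulrBl opprD addrACA subrr addr0 normrM [`|2^-1|]ger0_norm// exprSr ler_pM2r.
Qed.

Lemma nrm_mean (a b c d : F) e : nrm (a - c) <= e -> nrm (b - d) <= e ->
  nrm (2^-1 *: (a + b) - 2^-1 *: (c + d)) <= e.
Proof.
move=> ac bd; rewrite -scalerBr nrmZ nrm_half mulrC ler_pdivrMr//.
rewrite mulr_natr mulr2n opprD addrACA (le_trans (nrmD _ _))//; exact: lerD.
Qed.

Lemma half_double (x : F) : 2^-1 *: (x + x) = x.
Proof. by rewrite -[x + x]mulr2n -[x *+ 2]scaler_nat scalerA mulVf ?scale1r// pnatr_eq0. Qed.

Lemma dyadic_sum_osc g n p e : (n <= p)%N -> oscillation g n e ->
  nrm (dyadic_sum p g - dyadic_sum n g) <= e.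
Proof.
elim: n p g => [|n IH] [|p]//= g; rewrite ?ltnS => np og.
- by rewrite subrr nrm0; have := og 0 0; rewrite !subrr nrm0 normr0 expr0; apply; lra.
(* At level [0] the coarse sum is [g 0], which is also the dyadic sum of a constant; the difference
   is then bounded by the oscillation over the whole interval. *)
- have bd h : (forall t : R, 0 <= t <= 1 -> nrm (h t - g 0) <= e) ->
    nrm (dyadic_sum p h - g 0) <= e.
    move=> hg; have cE q : dyadic_sum q (fun=> - g 0) = - g 0.
      elim: q => [//|q /= IHq]; rewrite /left_half /right_half IHq.
      exact: half_double.
    by rewrite -(cE p) -dyadic_sumD; apply: dyadic_sum_bound.
  rewrite -(half_double (g 0)).
  by apply: nrm_mean; apply: bd => t t01; apply: og; rewrite ?expr0 ?subr0 ?ger0_norm; lra.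
- by have [? ?] := oscillation_half og; apply: nrm_mean; exact: IH.
Qed.

(* The second-order remainder of [G] is halved by passing to the halves. *)
Lemma dyadic_sum_ftc n (G g : R -> F) K :
  (forall t s : R, 0 <= t -> 0 <= s -> t + s <= 1 ->
    nrm (G (t + s) - G t - s%:C%C *: g t) <= K * s ^+ 2) ->
  nrm (dyadic_sum n g - (G 1 - G 0)) <= K * 2^-1 ^+ n.
Proof.
elim: n G g K => [|n IH] G g K H /=.
  have := H 0 1; rewrite add0r scale1r expr1n expr0 nrm_distC; apply; lra.
(* Antiderivatives of the two halves of [g] are [2 G (t / 2)] and [2 G ((t + 1) / 2)]. Their
   remainder constant is [2 * K / 4], that is [K / 2]. *)
have -> : G 1 - G 0 = 2^-1 *: ((2 *: G (1 / 2) - 2 *: G (0 / 2)) +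
                             (2 *: G ((1 + 1) / 2) - 2 *: G ((0 + 1) / 2))).
  have -> : (1 + 1) / 2 = 1 :> R by field.
  rewrite add0r mul0r [X in _ *: X]addrC addrA subrK -scalerBr scalerA.
  by rewrite mulVf ?scale1r// pnatr_eq0.
have two : nrm (2 : R[i]) = 2.
  by rewrite -[2](rmorph_nat (real_complex R)) nrmC ger0_norm.
have hE (s : R) (x : F) : s%:C%C *: x = 2%:R *: ((s / 2)%:C%C *: x).
  rewrite scalerA; congr (_ *: _); rewrite -[2%:R](rmorph_nat (real_complex R)).
  by rewrite -rmorphM /= mulrC divfK ?pnatr_eq0.
rewrite exprS mulrA; apply: nrm_mean.
  apply: (IH (fun t => 2 *: G (t / 2))) => t s t0 s0 ts.
  rewrite hE -!scalerBr nrmZ two [(t + s) / 2]mulrDl.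
  have /H : 0 <= t / 2 by lra. move=> /(_ (s / 2)).
  have -> : (s / 2) ^+ 2 = s ^+ 2 / 4 by field.
  by move=> H'; have := H' _ _; lra.
apply: (IH (fun t => 2 *: G ((t + 1) / 2))) => t s t0 s0 ts.
rewrite hE -!scalerBr nrmZ two.
have -> : (t + s + 1) / 2 = (t + 1) / 2 + s / 2 by ring.
have /H : 0 <= (t + 1) / 2 by lra. move=> /(_ (s / 2)).
have -> : (s / 2) ^+ 2 = s ^+ 2 / 4 by field.
by move=> H'; have := H' _ _; lra.
Qed.

Definition continuous01 g := forall t : R, 0 <= t <= 1 -> forall e : R, 0 < e ->
  exists2 d : R, 0 < d & forall s : R, 0 <= s <= 1 -> `|s - t| < d -> nrm (g s - g t) <= e.

Lemma continuous01_half g : continuous01 g ->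
  continuous01 (left_half g) /\ continuous01 (right_half g).
Proof.
move=> cg; split=> t t01 e e0.
  have [|d d0 dP] := cg (t / 2) _ e e0; first lra.
  exists d => // s s01 st; apply: dP; first lra.
  rewrite -mulrBl normrM [`|2^-1|]ger0_norm// ltr_pdivrMr//.
  by rewrite (lt_le_trans st)// ler_pMr// ler1n.
have [|d d0 dP] := cg ((t + 1) / 2) _ e e0; first lra.
exists d => // s s01 st; apply: dP; first lra.
rewrite -mulrBl opprD addrACA subrr addr0 normrM [`|2^-1|]ger0_norm// ltr_pdivrMr//.
by rewrite (lt_le_trans st)// ler_pMr// ler1n.
Qed.

Lemma continuous01_oscillation g e : continuous01 g -> 0 < e ->
  exists n, oscillation g n e.
Proof.
move=> cg e0.
suff [d d0 dP] : exists2 d : R, 0 < d & forall s t : R, 0 <= s <= 1 -> 0 <= t <= 1 ->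
    `|s - t| < d -> nrm (g s - g t) <= e.
  have [n /(_ n (leqnn n))] := half_pow_small 1 d0; rewrite mul1r => nd.
  by exists n => s t s01 t01 st; apply: dP => //; exact: le_lt_trans nd.
(* Heine's theorem: only [s] is confined to the current interval while [t] ranges over all of
   [[0, 1]], so gluing two halves just takes the smaller [d]. *)
apply: (@bisection R (fun a b => exists2 d : R, 0 < d & forall s t : R,
  a <= s <= b -> 0 <= t <= 1 -> `|s - t| < d -> nrm (g s - g t) <= e)) => //.
  move=> a b m ab mE [d1 d10 d1P] [d2 d20 d2P].
  exists (Num.min d1 d2) => [|s t /andP[sa sb] t01]; first by rewrite lt_min d10.
  rewrite lt_min => /andP[s1 s2].
  by have [sm|/ltW sm] := leP s m; [apply: d1P|apply: d2P] => //; apply/andP.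
move=> x x01; have [d d0 dP] := cg x x01 _ (divr_gt0 e0 (ltr0Sn _ 1)).
exists (d / 2) => [|a b a0 axb b1 ba]; first lra.
exists (d / 2) => [|s t sab t01]; first lra.
rewrite ltr_norml => st.
rewrite (le_trans (nrm_tri (g x) _ _))// [e in _ <= e]splitr lerD//.
  by apply: dP; rewrite ?ltr_norml; lra.
by rewrite nrm_distC; apply: dP; rewrite ?ltr_norml; lra.
Qed.

(** A relation rather than a function: it makes sense without completeness, and sums, multiples and
    antiderivatives then yield integrals with no separate convergence argument. *)
Definition is_int g v := forall e : R, 0 < e -> exists n0, forall n, (n0 <= n)%N ->
  nrm (dyadic_sum n g - v) <= e.

Lemma is_int_unique g v w : is_int g v -> is_int g w -> v = w.
Proof.
move=> gv gw; apply/subr0_eq/nrm_le0/le_eps => e e0; rewrite add0r.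
have e2 : 0 < e / 2 by lra.
have [n nP] := gv _ e2; have [p pP] := gw _ e2.
have := nP _ (leq_maxl n p); have := pP _ (leq_maxr n p).
set s := dyadic_sum _ _ => sw; rewrite nrm_distC => vs.
by rewrite (le_trans (nrm_tri s _ _))// [e]splitr lerD.
Qed.

Lemma is_intD g h v w : is_int g v -> is_int h w -> is_int (g \+ h) (v + w).
Proof.
move=> gv hw e e0; have e2 : 0 < e / 2 by lra.
have [n nP] := gv _ e2; have [p pP] := hw _ e2.
exists (maxn n p) => q; rewrite geq_max => /andP[/nP nq /pP pq].
rewrite dyadic_sumD opprD addrACA (le_trans (nrmD _ _))// [e]splitr; exact: lerD.
Qed.

Lemma is_intZ a g v : is_int g v -> is_int (fun t => a *: g t) (a *: v).
Proof.
move=> gv e e0; have a1 : 0 < nrm a + 1 by rewrite ltr_wpDl ?nrm_ge0.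
have [n nP] := gv _ (divr_gt0 e0 a1); exists n => p /nP pP.
rewrite dyadic_sumZ -scalerBr nrmZ (@le_trans _ _ ((nrm a + 1) * (e / (nrm a + 1))))//.
  by rewrite ler_pM ?nrm_ge0// lerDl.
by rewrite mulrC divfK ?gt_eqF.
Qed.

Lemma is_int_sum m (g : 'I_m -> R -> F) (v : 'I_m -> F) :
  (forall i, is_int (g i) (v i)) -> is_int (fun t => \sum_i g i t) (\sum_i v i).
Proof.
elim: m g v => [|m IH] g v H.
  rewrite big_ord0 => e e0; exists 0%N => n _.
  have -> : (fun t => \sum_(i < 0) g i t) = (fun t => (0 : R[i]) *: 0).
    by apply/funext => t; rewrite big_ord0 scaler0.
  by rewrite dyadic_sumZ scale0r subr0 nrm0 ltW.
rewrite big_ord_recl; have -> : (fun t => \sum_i g i t) =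
    (g ord0) \+ (fun t => \sum_(i < m) g (lift ord0 i) t).
  by apply/funext => t; rewrite big_ord_recl.
by apply: is_intD => //; apply: IH => i; exact: H.
Qed.

Lemma is_int_halves g v w : is_int (left_half g) v -> is_int (right_half g) w ->
  is_int g (2^-1 *: (v + w)).
Proof.
move=> gv gw e e0; have [n nP] := gv _ e0; have [p pP] := gw _ e0.
exists (maxn n p).+1 => -[//|q]; rewrite ltnS geq_max => /andP[/nP nq /pP pq].
exact: nrm_mean.
Qed.

Lemma is_int_bound g v M : (forall t : R, 0 <= t <= 1 -> nrm (g t) <= M) ->
  is_int g v -> nrm v <= M.
Proof.
move=> gM gv; apply/le_eps => e e0; have [n /(_ _ (leqnn n)) nP] := gv _ e0.
rewrite -[v](subKr (dyadic_sum n g)) (le_trans (nrmB _ _))// lerD//.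
exact: dyadic_sum_bound.
Qed.

Lemma is_int_osc g v n e : oscillation g n e -> is_int g v ->
  nrm (dyadic_sum n g - v) <= e.
Proof.
move=> og gv; apply/le_eps => d d0; have [p pP] := gv _ d0.
rewrite (le_trans (nrm_tri (dyadic_sum (maxn n p) g) _ _))// lerD ?pP ?leq_maxr//.
by rewrite nrm_distC; apply: dyadic_sum_osc => //; rewrite leq_maxl.
Qed.

Lemma is_int_ftc (G g : R -> F) K :
  (forall t s : R, 0 <= t -> 0 <= s -> t + s <= 1 ->
    nrm (G (t + s) - G t - s%:C%C *: g t) <= K * s ^+ 2) ->
  is_int g (G 1 - G 0).
Proof.
move=> H e e0; have [n nP] := half_pow_small K e0; exists n => p /nP/ltW.
exact/le_trans/dyadic_sum_ftc.
Qed.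

End NormedSpace.

Section Banach.
Context {F : completeNormedModType R[i]}.
Implicit Types (g : R -> F) (v : F).

(** The value is [0] when the dyadic sums do not converge. *)
Definition dint g : F := xget 0 [set v | is_int g v].

Lemma dintP g : continuous01 g -> is_int g (dint g).
Proof.
move=> cg; suff [l gl] : exists l, is_int g l by apply: (xgetI _ gl).
apply: complete_nrm => e e0.
have [n on] := continuous01_oscillation cg (divr_gt0 e0 (ltr0Sn _ 1)).
exists n => p q np nq; rewrite (le_trans (nrm_tri (dyadic_sum n g) _ _))//.
by rewrite [e]splitr lerD 1?[nrm (dyadic_sum n g - _)]nrm_distC ?dyadic_sum_osc.
Qed.

Lemma dintE g v : is_int g v -> dint g = v.
Proof. by move=> gv; apply: (is_int_unique _ gv); apply: (xgetI _ gv). Qed.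

Lemma dint_halves g : continuous01 g ->
  dint g = 2^-1 *: (dint (left_half g) + dint (right_half g)).
Proof.
by move=> /continuous01_half[/dintP gl /dintP gr]; apply/dintE/is_int_halves.
Qed.

End Banach.
End DyadicIntegral.

(** * Goursat's theorem *)

Section Goursat.
Context {R : realType} {F : completeNormedModType R[i]}.
Implicit Types (u : R[i] -> F) (p q w z : R[i]) (l : F).

Definition cderiv u z l := forall e : R, 0 < e -> exists2 d : R, 0 < d &
  forall h, nrm h < d -> nrm (u (z + h) - u z - h *: l) <= e * nrm h.

Definition ccontinuous u z := forall e : R, 0 < e -> exists2 d : R, 0 < d &
  forall h, nrm h < d -> nrm (u (z + h) - u z) <= e.

Lemma cderiv_continuous u z l : cderiv u z l -> ccontinuous u z.
Proof.
move=> dz; apply: (@deriv_at_continuous _ R[i]^o F u z (fun h : R[i]^o => (h : R[i]) *: l) (nrm l)) => //.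
by move=> h; rewrite nrmZ mulrC.
Qed.

Definition seg_point p q (t : R) : R[i] := p + t%:C%C * (q - p).

Definition seg_int u p q : F := (q - p) *: dint (fun t => u (seg_point p q t)).

Lemma seg_point_continuous u p q :
  (forall t : R, 0 <= t <= 1 -> ccontinuous u (seg_point p q t)) ->
  continuous01 (fun t => u (seg_point p q t)).
Proof.
move=> cu t t01 e e0; have [d d0 dP] := cu t t01 e e0.
have k1 : 0 < nrm (q - p) + 1 by rewrite ltr_wpDl ?nrm_ge0.
exists (d / (nrm (q - p) + 1)) => [|s _ st]; first exact: divr_gt0.
have -> : seg_point p q s = seg_point p q t + (s - t)%:C%C * (q - p).
  by rewrite /seg_point rmorphB /=; ring.
apply: dP; rewrite nrmM nrmC (@le_lt_trans _ _ (`|s - t| * (nrm (q - p) + 1)))//.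
  by rewrite ler_wpM2l ?lerDl.
by rewrite -ltr_pdivlMr.
Qed.

Lemma seg_int_half u p q m : m = (p + q) / 2 ->
  continuous01 (fun t => u (seg_point p q t)) ->
  seg_int u p q = seg_int u p m + seg_int u m q.
Proof.
move=> mE cu; rewrite /seg_int (dint_halves cu).
have c2 : (2 : R[i]) != 0 by rewrite pnatr_eq0.
have half (t : R) : (t / 2)%:C%C = t%:C%C / 2 :> R[i].
  by rewrite rmorphM fmorphV rmorph_nat.
have -> : left_half (fun t => u (seg_point p q t)) = fun t => u (seg_point p m t).
  apply/funext => t; rewrite /left_half /seg_point mE half; congr (u _).
  by field.
have -> : right_half (fun t => u (seg_point p q t)) = fun t => u (seg_point m q t).
  apply/funext => t; rewrite /right_half /seg_point mE half rmorphD rmorph1 /=.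
  by congr (u _); field.
rewrite scalerA scalerDr; congr (_ *: _ + _ *: _); rewrite mE; field => //.
Qed.

Lemma seg_int_bound u p q M : continuous01 (fun t => u (seg_point p q t)) ->
  (forall t : R, 0 <= t <= 1 -> nrm (u (seg_point p q t)) <= M) ->
  nrm (seg_int u p q) <= nrm (q - p) * M.
Proof.
move=> cu uM; rewrite nrmZ ler_wpM2l ?nrm_ge0//.
exact: is_int_bound (dintP cu).
Qed.

(* An affine function has the primitive [w *: A + (w ^+ 2 / 2) *: l]. *)
Lemma seg_int_affine u (A l : F) p q : 
  continuous01 (fun t => u (seg_point p q t)) ->
  seg_int u p q = seg_int (fun w => u w - (A + w *: l)) p q +
    ((q *: A + (q ^+ 2 / 2) *: l) - (p *: A + (p ^+ 2 / 2) *: l)).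
Proof.
move=> cu; have [->|pq] := eqVneq p q.
  by rewrite /seg_int !subrr !scale0r addr0.
pose P w := w *: A + (w ^+ 2 / 2) *: l.
rewrite -[_ *: _ + _ *: _ in X in _ - X]/(P p) -[_ *: _ + _ *: _ in X in X - _]/(P q).
pose aff w := A + w *: l.
have lin3 (x y x' y' k w : R[i]) :
    (x *: A + y *: l) - (x' *: A + y' *: l) - k *: (A + w *: l) =
    (x - x' - k) *: A + (y - y' - k * w) *: l.
  by rewrite scalerDr scalerA !scalerBl !opprD [X in X + _ = _]addrACA [LHS]addrACA.
have c2 : (2 : R[i]) != 0 by rewrite pnatr_eq0.
(* The primitive is quadratic, so its remainder along the segment is exactly [s ^ 2] times a
   constant vector, as [is_int_ftc] requires. *)
have iP : is_int (fun t : R => (q - p) *: aff (seg_point p q t)) (P q - P p).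
  have -> : P q = P (seg_point p q 1) by rewrite /seg_point mul1r subrKC.
  have -> : P p = P (seg_point p q 0) by rewrite /seg_point mul0r addr0.
  apply: (@is_int_ftc _ _ (fun t => P (seg_point p q t)) _ (nrm ((q - p) ^+ 2 / 2) * nrm l)).
  move=> t s t0 s0 ts; rewrite le_eqVlt; apply/orP; left.
  have -> : P (seg_point p q (t + s)) - P (seg_point p q t) -
      s%:C%C *: ((q - p) *: aff (seg_point p q t)) =
      (s%:C%C ^+ 2 * ((q - p) ^+ 2 / 2)) *: l.
    rewrite scalerA /P /aff lin3 [X in X *: A](_ : _ = 0) ?scale0r ?add0r.
      by congr (_ *: _); rewrite /seg_point rmorphD /=; field.
    by rewrite /seg_point rmorphD /=; ring.
  by rewrite nrmZ nrmM expr2 nrmM nrmC ger0_norm// expr2; apply/eqP; ring.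
have iu : is_int (fun t : R => (q - p) *: u (seg_point p q t)) (seg_int u p q).
  exact/is_intZ/dintP.
have -> : seg_int (fun w => u w - (A + w *: l)) p q = seg_int u p q - (P q - P p).
  have iP' : is_int (fun t => aff (seg_point p q t)) ((q - p)^-1 *: (P q - P p)).
    have -> : (fun t => aff (seg_point p q t)) =
      fun t => (q - p)^-1 *: ((q - p) *: aff (seg_point p q t)).
      by apply/funext => t; rewrite scalerK// subr_eq0 eq_sym.
    exact: is_intZ.
  rewrite {1}/seg_int; have -> : dint (fun t => u (seg_point p q t) -
      (A + seg_point p q t *: l)) =
      dint (fun t => u (seg_point p q t)) + (-1) *: ((q - p)^-1 *: (P q - P p)).
    apply: dintE; have -> : (fun t => u (seg_point p q t) - (A + seg_point p q t *: l)) =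
      (fun t => u (seg_point p q t)) \+ (fun t => (-1) *: aff (seg_point p q t)).
      by apply/funext => t /=; rewrite scaleN1r.
    by apply: is_intD (dintP cu) _; exact: is_intZ.
  rewrite scalerDr scaleN1r scalerN scalerA mulfV ?scale1r// subr_eq0 eq_sym//.
by rewrite subrK.
Qed.

(** The counterclockwise boundary; the top and left sides carry a minus sign because every side is
    parametrized in the increasing direction. *)
Definition boundary_int u (a b c d : R) : F :=
  seg_int u (Complex a c) (Complex b c) - seg_int u (Complex a d) (Complex b d) +
  (seg_int u (Complex b c) (Complex b d) - seg_int u (Complex a c) (Complex a d)).

Lemma seg_pointE (a b c d t : R) : seg_point (Complex a c) (Complex b d) t =
  Complex (a + t * (b - a)) (c + t * (d - c)).
Proof. by rewrite /seg_point; apply/eqP; rewrite eq_complex /=; apply/andP; split; apply/eqP; ring. Qed.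

Lemma complex_half (a b c d : R) :
  Complex ((a + b) / 2) ((c + d) / 2) = (Complex a c + Complex b d) / 2.
Proof.
rewrite -[2 in RHS](rmorph_nat (real_complex R)) -fmorphV.
by apply/eqP; rewrite eq_complex /=; apply/andP; split; apply/eqP; ring.
Qed.

Lemma between_convex (a b x y t : R) : a <= x <= b -> a <= y <= b -> 0 <= t <= 1 ->
  a <= x + t * (y - x) <= b.
Proof.
move=> /andP[ax xb] /andP[ay yb] /andP[t0 t1].
have -> : x + t * (y - x) = (1 - t) * x + t * y by ring.
have u0 : 0 <= 1 - t by rewrite subr_ge0.
apply/andP; split.
  have -> : a = (1 - t) * a + t * a by ring.
  by rewrite lerD// ler_wpM2l.
have -> : b = (1 - t) * b + t * b by ring.
by rewrite lerD// ler_wpM2l.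
Qed.

Lemma seg_continuous_in u (a b c d x1 x2 y1 y2 : R) :
  (forall x y, a <= x <= b -> c <= y <= d -> exists l, cderiv u (Complex x y) l) ->
  a <= x1 <= b -> a <= x2 <= b -> c <= y1 <= d -> c <= y2 <= d ->
  continuous01 (fun t => u (seg_point (Complex x1 y1) (Complex x2 y2) t)).
Proof.
move=> du x1ab x2ab y1cd y2cd; apply: seg_point_continuous => t t01.
rewrite seg_pointE; have [||l /cderiv_continuous//] := du (x1 + t * (x2 - x1))
  (y1 + t * (y2 - y1)); exact: between_convex.
Qed.

Lemma boundary_int_quarters u (a b c d m k : R) : a <= b -> c <= d ->
  m = (a + b) / 2 -> k = (c + d) / 2 ->
  (forall x y, a <= x <= b -> c <= y <= d -> exists l, cderiv u (Complex x y) l) ->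
  boundary_int u a b c d =
    (boundary_int u a m c k + boundary_int u m b c k) +
    (boundary_int u a m k d + boundary_int u m b k d).
Proof.
move=> ab cd mE kE du.
have ia : a <= a <= b by rewrite lexx.
have ib : a <= b <= b by rewrite lexx andbT.
have ic : c <= c <= d by rewrite lexx.
have id : c <= d <= d by rewrite lexx andbT.
have hh y : c <= y <= d -> seg_int u (Complex a y) (Complex b y) =
    seg_int u (Complex a y) (Complex m y) + seg_int u (Complex m y) (Complex b y).
  move=> yd; apply: seg_int_half; last exact: (seg_continuous_in du).
  by rewrite -complex_half mE; congr Complex; field.
have vv x : a <= x <= b -> seg_int u (Complex x c) (Complex x d) =
    seg_int u (Complex x c) (Complex x k) + seg_int u (Complex x k) (Complex x d).
  move=> xd; apply: seg_int_half; last exact: (seg_continuous_in du).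
  by rewrite -complex_half kE; congr Complex; field.
(* Cancels the vertical side [w] shared by two rectangles in the same row; the horizontal sides
   between the two rows cancel afterwards. *)
have row (p p' q q' v w x : F) : (p - p' + (w - v)) + (q - q' + (x - w)) =
    (p + q) - (p' + q') + (x - v).
  by rewrite addrACA [p - p' + _]addrACA -opprD [w - v + _]addrC subrKA.
rewrite /boundary_int !row [RHS in _ = RHS]addrACA subrKA.
rewrite [X in _ = _ + X]addrACA -opprD.
by rewrite -(hh c ic) -(hh d id) -(vv a ia) -(vv b ib).
Qed.

(** An affine function has a primitive, whose increments cancel around the boundary. This removes
    the first-order part of [u] from the local estimate in Goursat's theorem. *)
Lemma boundary_int_affine u (A l : F) (a b c d : R) : a <= b -> c <= d ->
  (forall x y, a <= x <= b -> c <= y <= d -> exists l, cderiv u (Complex x y) l) ->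
  boundary_int u a b c d = boundary_int (fun w => u w - (A + w *: l)) a b c d.
Proof.
move=> ab cd du.
have ia : a <= a <= b by rewrite lexx.
have ib : a <= b <= b by rewrite lexx andbT.
have ic : c <= c <= d by rewrite lexx.
have id : c <= d <= d by rewrite lexx andbT.
have cs x1 x2 y1 y2 (h1 : a <= x1 <= b) (h2 : a <= x2 <= b)
  (h3 : c <= y1 <= d) (h4 : c <= y2 <= d) := 
  seg_int_affine A l (seg_continuous_in du h1 h2 h3 h4).
rewrite /boundary_int !cs//.
set PA := Complex a c *: _ + _; set PB := Complex b c *: _ + _.
set PC := Complex a d *: _ + _; set PD := Complex b d *: _ + _.
set s1 := seg_int _ _ _; set s2 := seg_int _ (Complex a d) _.
set s3 := seg_int _ (Complex b c) _; set s4 := seg_int _ _ _.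
clearbody PA PB PC PD s1 s2 s3 s4.
have -> : s1 + (PB - PA) - (s2 + (PD - PC)) = s1 - s2 + ((PB - PA) - (PD - PC)).
  by rewrite opprD addrACA.
have -> : s3 + (PD - PB) - (s4 + (PC - PA)) = s3 - s4 + ((PD - PB) - (PC - PA)).
  by rewrite opprD addrACA.
rewrite addrACA [X in _ + X](_ : _ = 0) ?addr0//.
apply/eqP; rewrite addr_eq0; apply/eqP.
by rewrite !opprB addrACA [in RHS]addrACA [PC + PB]addrC.
Qed.

Lemma boundary_int_bound u (M a b c d : R) : a <= b -> c <= d -> 0 <= M ->
  (forall x y, a <= x <= b -> c <= y <= d -> ccontinuous u (Complex x y)) ->
  (forall x y, a <= x <= b -> c <= y <= d -> nrm (u (Complex x y)) <= M) ->
  nrm (boundary_int u a b c d) <= 2 * ((b - a) + (d - c)) * M.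
Proof.
move=> ab cd M0 cu uM.
have sb (x1 x2 y1 y2 : R) : a <= x1 <= b -> a <= x2 <= b -> c <= y1 <= d -> c <= y2 <= d ->
    nrm (seg_int u (Complex x1 y1) (Complex x2 y2)) <= (`|x2 - x1| + `|y2 - y1|) * M.
  move=> h1 h2 h3 h4; apply: (@le_trans _ _
      (nrm (Complex x2 y2 - Complex x1 y1 : R[i]) * M)); last first.
    by rewrite ler_wpM2r// (le_trans _ (nrm_complex _ _)).
  apply: seg_int_bound => [|t t01].
    apply: seg_point_continuous => t t01; rewrite seg_pointE.
    by apply: cu; exact: between_convex.
  by rewrite seg_pointE; apply: uM; exact: between_convex.
have ia : a <= a <= b by rewrite lexx.
have ib : a <= b <= b by rewrite lexx andbT.
have ic : c <= c <= d by rewrite lexx.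
have id : c <= d <= d by rewrite lexx andbT.
have := sb _ _ _ _ ia ib ic ic; have := sb _ _ _ _ ia ib id id.
have := sb _ _ _ _ ib ib ic id; have := sb _ _ _ _ ia ia ic id.
rewrite !subrr normr0 !add0r !addr0 !ger0_norm ?subr_ge0//.
move=> h1 h2 h3 h4; rewrite (le_trans (nrmD _ _))//.
rewrite (le_trans (lerD (nrmB _ _) (nrmB _ _)))//.
rewrite (le_trans (lerD (lerD h4 h3) (lerD h2 h1)))//.
by rewrite le_eqVlt; apply/orP; left; apply/eqP; ring.
Qed.

Lemma cderiv_affine u z l (A B : F) : cderiv u z l ->
  exists l', cderiv (fun w => u w - (A + w *: B)) z l'.
Proof.
move=> du; exists (l - B) => e /du[d d0 dP]; exists d => // h /dP.
have -> // : u (z + h) - (A + (z + h) *: B) - (u z - (A + z *: B)) - h *: (l - B) =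
  u (z + h) - u z - h *: l.
have abelian (U V a x y : F) : U - (a + x) - (V - a) - (y - x) = U - V - y.
  by rewrite !opprB -addrA [a - V + _]addrACA addrA subrK addrA.
by rewrite scalerDl addrA scalerBr abelian.
Qed.

Lemma goursat u (a b c d : R) : a <= b -> c <= d ->
  (forall x y, a <= x <= b -> c <= y <= d -> exists l, cderiv u (Complex x y) l) ->
  boundary_int u a b c d = 0.
Proof.
move=> ab cd du; apply/nrm_le0/le_eps => e0 e00; rewrite add0r.
(* The sum of the squared sides is compatible with gluing, since each quarter contributes a fourth
   of it, and it dominates the squared perimeter whatever the shape of the rectangle. *)
suff H (e : R) : 0 < e -> nrm (boundary_int u a b c d) <= e * ((b - a) ^+ 2 + (d - c) ^+ 2).
  have h1 : 0 < (b - a) ^+ 2 + (d - c) ^+ 2 + 1 by rewrite ltr_wpDl// addr_ge0 ?sqr_ge0.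
  rewrite (le_trans (H _ (divr_gt0 e00 h1)))// mulrAC ler_pdivrMr// ler_wpM2l ?ltW// ltrDl//.
move=> {e00}e0'; have sub a' b' c' d' : a <= a' -> b' <= b -> c <= c' -> d' <= d ->
    forall x y : R, a' <= x <= b' -> c' <= y <= d' -> exists l, cderiv u (Complex x y) l.
  move=> aa bb cc dd x y /andP[ax xb] /andP[cy yd].
  by apply: du; rewrite (le_trans aa, le_trans cc)//= (le_trans _ bb, le_trans _ dd).
pose P a' b' c' d' := [/\ a <= a', b' <= b, c <= c' & d' <= d] ->
  nrm (boundary_int u a' b' c' d') <= e * ((b' - a') ^+ 2 + (d' - c') ^+ 2).
suff : P a b c d by apply.
apply: quadrisection => //.
  move=> a' b' c' d' m k ab' cd' mE kE P1 P2 P3 P4 [aa bb cc dd].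
  have [am mb] : a' <= m /\ m <= b' by split; lra.
  have [ck kd] : c' <= k /\ k <= d' by split; lra.
  have mb' := le_trans mb bb; have am' := le_trans aa am.
  have kd' := le_trans kd dd; have ck' := le_trans cc ck.
  have Q1 := P1 (And4 aa mb' cc kd'); have Q2 := P2 (And4 am' bb cc kd').
  have Q3 := P3 (And4 aa mb' ck' dd); have Q4 := P4 (And4 am' bb ck' dd).
  rewrite (boundary_int_quarters ab' cd' mE kE (sub _ _ _ _ aa bb cc dd)).
  rewrite (le_trans (nrmD _ _))// (le_trans (lerD (nrmD _ _) (nrmD _ _)))//.
  move: Q1 Q2 Q3 Q4; rewrite mE kE; clear; lra.
move=> x y xab ycd; have [l dl] := du x y xab ycd.
(* With [s] the sum of the two sides, the boundary bound is [2 * s * (e / 4 * s)], and [s ^ 2] is at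
   most twice the sum of the squared sides. *)
have e4 : 0 < e / 4 by rewrite divr_gt0.
have [r r0 rP] := dl (e / 4) e4.
exists (r / 2) => [|a' b' c' d' aa axb bb cc cyd dd br dr _]; first by rewrite divr_gt0.
pose z := Complex x y.
have ab' : a' <= b' by case/andP: axb => h /(le_trans h).
have cd' : c' <= d' by case/andP: cyd => h /(le_trans h).
have du' := sub _ _ _ _ aa bb cc dd.
have M0 : 0 <= e / 4 * ((b' - a') + (d' - c')).
  by rewrite mulr_ge0 ?(ltW e4)// addr_ge0// subr_ge0.
rewrite (boundary_int_affine (u z - z *: l) l ab' cd' du').
apply: (le_trans (boundary_int_bound (M := e / 4 * ((b' - a') + (d' - c'))) ab' cd' M0 _ _)).
- move=> x' y' xx yy; have [l' dl'] := du' x' y' xx yy.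
  by have [l'' /cderiv_continuous] := cderiv_affine (u z - z *: l) l dl'.
- move=> x' y' xx yy; set w := Complex x' y'.
  have wz : nrm (w - z) <= (b' - a') + (d' - c').
    apply: (le_trans (nrm_complex _ _)).
    move: axb cyd xx yy; clear; move=> ? ? ? ?; apply: lerD; rewrite ler_norml; lra.
  have /rP : nrm (w - z) < r by move: wz br dr; clear; lra.
  have -> : u w - (u z - z *: l + w *: l) = u w - u z - (w - z) *: l.
    by rewrite scalerBl -addrA [- _ + _]addrC opprD addrA.
  by rewrite subrKC => /le_trans; apply; rewrite ler_wpM2l// ltW.
have : 0 <= e * ((b' - a') - (d' - c')) ^+ 2 by rewrite mulr_ge0 ?sqr_ge0// ltW.
clear; lra.
Qed.
End Goursat.

(** * Cauchy estimates *)

Section ComplexExponential.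
Context {R : realType}.

Definition cexp (z : R[i]) : R[i] :=
  (expR (complex.Re z))%:C%C * Complex (cos (complex.Im z)) (sin (complex.Im z)).

Lemma cexpD z w : cexp (z + w) = cexp z * cexp w.
Proof.
case: z w => [a b] [c d]; rewrite /cexp /= expRD cosD sinD rmorphM /= mulrACA.
by congr (_ * _); apply/eqP; rewrite eq_complex /= eqxx/= addrC eqxx.
Qed.

Lemma cexp0 : cexp 0 = 1.
Proof. by rewrite /cexp /= expR0 cos0 sin0 mul1r. Qed.

Lemma nrm_cexp z : nrm (cexp z) = expR (complex.Re z).
Proof.
by rewrite /cexp nrmM nrmC ger0_norm ?expR_ge0// /nrm normc_def /= cos2Dsin2 sqrtr1 mulr1.
Qed.

Lemma cexp_periodic (a b : R) : cexp (Complex a (b + pi *+ 2)) = cexp (Complex a b).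
Proof. by rewrite /cexp /= cosD2pi sinD2pi. Qed.

Lemma real_deriv_bound (f : R -> R) (df : R) : is_derive (0 : R) (1 : R) f df ->
  forall e : R, 0 < e -> exists2 d : R, 0 < d &
    forall h, `|h| < d -> `|f h - f 0 - h * df| <= e * `|h|.
Proof.
move=> [df1 df2] e e0; have /eqaddoP /(_ e e0) := derivable_nbhs df1.
rewrite near_simpl => /nbhs_norm0P[d /= d0 dP]; exists d => // h /dP.
rewrite df2; have -> : ((fun h0 => (f \o shift 0) (h0 *: 1)) -
  (cst (f 0) + (fun h0 => h0 *: df))) h = f (h * 1 + 0) - (f 0 + h * df) by [].
by rewrite mulr1 addr0 opprD addrA.
Qed.

Lemma cexp_deriv0 (e : R) : 0 < e -> exists2 d : R, 0 < d &
  forall h, nrm h < d -> nrm (cexp h - 1 - h) <= e * nrm h.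
Proof.
(* The three terms of the decomposition below cost [4], [2] and [1] times [e / 8 * n]. *)
move=> e0; have e8 : 0 < e / 8 by rewrite divr_gt0.
have [d1 d10 d1P] := real_deriv_bound (is_derive_expR 0) e8.
have [d2 d20 d2P] := real_deriv_bound (is_derive_cos 0) e8.
have [d3 d30 d3P] := real_deriv_bound (is_derive_sin 0) e8.
have [d4 d40 d4P] := real_deriv_bound (is_derive_expR 0) (ltr01).
rewrite expR0 in d1P d4P; rewrite sin0 oppr0 cos0 in d2P; rewrite cos0 sin0 in d3P.
pose d := Num.min (Num.min (Num.min d1 d2) (Num.min d3 d4)) (Num.min (1 / 2) (e / 8)).
exists d => [|[x y] hd]; first by rewrite !lt_min d10 d20 d30 d40 e8 divr_gt0.
set n := nrm _ in hd *.
have xn : `|x| <= n by exact: (nrm_Re (Complex x y)).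
have yn : `|y| <= n.
  have := nrm_Re ('i%C * Complex x y); rewrite /= mul0r mul1r sub0r normrN.
  rewrite nrmM; have -> : nrm ('i%C : R[i]) = 1; last by rewrite mul1r.
  by rewrite /nrm normc_def /= expr0n expr1n add0r sqrtr1.
move: hd; rewrite !lt_min => /andP[/andP[/andP[n1 n2] /andP[n3 n4]] /andP[n5 n6]].
have := d1P x (le_lt_trans xn n1); have := d4P x (le_lt_trans xn n4).
have := d2P y (le_lt_trans yn n2); have := d3P y (le_lt_trans yn n3).
rewrite !mulr0 !mulr1 !subr0 mul1r.
set X := expR x; set c := cos y; set s := sin y => hs hc hX hX'.
have -> : cexp (Complex x y) - 1 - Complex x y =
   X%:C%C * Complex (c - 1) (s - y) + Complex 0 (y * (X - 1)) + (X - 1 - x)%:C%C.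
  rewrite /cexp /= -/X -/c -/s; apply/eqP; rewrite eq_complex /=.
  by apply/andP; split; apply/eqP; ring.
have n0 : 0 <= n by exact: nrm_ge0.
have Xb : `|X - 1| <= 2 * n.
  have -> : X - 1 = (X - 1 - x) + x by ring.
  by rewrite (le_trans (ler_normD _ _))//; move: xn hX; clear; lra.
have X2 : `|X| <= 2.
  have -> : X = (X - 1) + 1 by ring.
  by rewrite (le_trans (ler_normD _ _))// normr1; move: Xb n5; clear; lra.
rewrite (le_trans (nrmD _ _))// nrmC.
rewrite (le_trans (lerD (nrmD _ _) (lexx _)))// nrmM nrmC.
have h1 : `|X| * nrm (Complex (c - 1) (s - y)) <= 2 * (e / 8 * n + e / 8 * n).
  rewrite ler_pM ?nrm_ge0// (le_trans (nrm_complex _ _))// lerD//.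
    by rewrite (le_trans hc)// ler_wpM2l// ltW.
  by rewrite (le_trans hs)// ler_wpM2l// ltW.
have h2 : nrm (Complex 0 (y * (X - 1))) <= n * (2 * (e / 8)).
  rewrite (le_trans (nrm_complex _ _))// normr0 add0r normrM ler_pM//.
  by rewrite (le_trans Xb)// ler_wpM2l// ltW.
have h3 : `|X - 1 - x| <= e / 8 * n.
  by rewrite (le_trans hX')// ler_wpM2l// ltW.
rewrite (le_trans (lerD (lerD h1 h2) h3))//.
have : 0 <= e * n by rewrite mulr_ge0// ltW.
clear; lra.
Qed.

Lemma cexp_differentiable (z : R[i]^o) : differentiable (cexp : R[i]^o -> R[i]^o) z.
Proof.
apply: (@deriv_differentiable _ _ _ _ _ (fun h : R[i]^o => h * cexp z) (nrm (cexp z))).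
- by move=> a x y; rewrite mulrDl -scalerAl.
- by move=> h; rewrite nrmM mulrC.
move=> e e0; have c1 : 0 < nrm (cexp z) + 1 by rewrite ltr_wpDl ?nrm_ge0.
have [d d0 dP] := cexp_deriv0 (divr_gt0 e0 c1); exists d => // h /dP hd.
have -> : cexp (z + h) - cexp z - h * cexp z = cexp z * (cexp h - 1 - h).
  by rewrite cexpD; ring.
rewrite nrmM (le_trans (ler_wpM2l (nrm_ge0 _) hd))// mulrA ler_wpM2r ?nrm_ge0//.
by rewrite mulrCA -[leRHS]mulr1 ler_wpM2l ?(ltW e0)// ler_pdivrMr// mul1r lerDl.
Qed.

End ComplexExponential.

(** * The first-order Cauchy estimate on a disc *)

Section Cauchy.
Context {R : realType} {F : completeNormedModType R[i]}.
Implicit Types (f : R[i]^o -> F) (z w h : R[i]) (l : F).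

Lemma cderiv_differentiable f z l : cderiv f z l -> differentiable f (z : R[i]^o).
Proof.
move=> df; apply: (@deriv_differentiable _ _ _ _ _ (fun h : R[i]^o => (h : R[i]) *: l) (nrm l)) => //.
- by move=> a x y; rewrite scalerDl scalerA.
- by move=> h; rewrite nrmZ mulrC.
Qed.

Lemma differentiable_cderiv f z : differentiable f (z : R[i]^o) -> cderiv f z ('d f (z : R[i]^o) (1 : R[i]^o)).
Proof.
move=> /differentiable_deriv df e /df[d d0 dP]; exists d => // h /dP.
suff -> : h *: 'd f (z : R[i]^o) (1 : R[i]^o) = 'd f (z : R[i]^o) (h : R[i]^o) by [].
by rewrite -linearZ; congr ('d f _ _); exact: mulr1.
Qed.

Lemma cderiv_unique f z l l' : cderiv f z l -> cderiv f z l' -> l = l'.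
Proof.
move=> dl dl'; have := @deriv_at_unique R R[i]^o F f z (fun h : R[i]^o => (h : R[i]) *: l)
  (fun h : R[i]^o => (h : R[i]) *: l').
move=> /(_ _ _ dl dl' (1 : R[i])); rewrite !scale1r; apply.
- by move=> a x; rewrite scalerA.
- by move=> a x; rewrite scalerA.
Qed.

Lemma cderiv_shift f z w l : cderiv f (z + w) l <-> cderiv (fun v => f (z + v)) w l.
Proof. by split=> df e /df[d d0 dP]; exists d => // h /dP; rewrite addrA. Qed.

Lemma differentiable_shift f z w : differentiable f (z + w : R[i]^o) ->
  differentiable (fun v : R[i]^o => f (z + v)) (w : R[i]^o).
Proof. by move=> /differentiable_cderiv/cderiv_shift/cderiv_differentiable. Qed.

(* In logarithmic coordinates the difference quotient at [0] becomes periodic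
   of period [2 pi i], and Goursat's theorem makes its mean over a circle
   independent of the radius. *)
Lemma cauchy_estimate0 f r M l : 0 < r ->
  (forall z, nrm z <= r -> differentiable f (z : R[i]^o)) ->
  (forall z, nrm z <= r -> nrm (f z) <= M) ->
  cderiv f 0 l -> nrm l <= 2 * M / r.
Proof.
move=> r0 df fM dl; apply: le_eps => e e0.
have [d d0 dP] := dl e e0.
(* With [w = cexp z], this is the quotient [(f w - f 0) / w]; it tends to [l] as the real part of
   [z] tends to minus infinity. *)
pose v (z : R[i]) := cexp (- z) *: (f (cexp z) - f 0).
(* The right side of the rectangle covers the circle of radius [r]. The left side covers one of
   radius at most [d / 2], on which [v] is within [e] of [l]. *)
pose b := ln r; pose a := Num.min (ln r) (ln (d / 2)).
have ab : a <= b by rewrite ge_min lexx.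
have pi2 : 0 <= pi *+ 2 :> R by rewrite mulrn_wge0// pi_ge0.
have expb (x : R) : x <= b -> expR x <= r.
  by move=> xb; rewrite -[r]lnK ?posrE// ler_expR.
have dv z : complex.Re z <= b -> differentiable (v : R[i]^o -> F) (z : R[i]^o).
  move=> zb; apply: (@differentiable_scale R R[i]^o F (fun z : R[i]^o => cexp (- z))
    (fun z => f (cexp z) - f 0)).
    apply: (@differentiable_comp _ _ _ _ (fun z : R[i]^o => - z) (cexp : R[i]^o -> R[i]^o)).
      exact: differentiableN.
    exact: cexp_differentiable.
  apply: differentiableB; last exact: differentiable_cst.
  apply: (@differentiable_comp _ _ _ _ (cexp : R[i]^o -> R[i]^o) f).
    exact: cexp_differentiable.
  by apply: df; rewrite nrm_cexp expb.
have dv' (x y : R) : a <= x <= b -> 0 <= y <= pi *+ 2 -> exists l, cderiv v (Complex x y) l.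
  move=> /andP[_ xb] _; exists ('d (v : R[i]^o -> F) (Complex x y : R[i]^o) (1 : R[i]^o)).
  exact/differentiable_cderiv/dv.
have vper (x y : R) : v (Complex x (y + pi *+ 2)) = v (Complex x y).
  rewrite /v cexp_periodic; congr (_ *: _).
  have -> : - Complex x (y + pi *+ 2) = Complex (- x) (- (y + pi *+ 2)) by [].
  by rewrite -[LHS]cexp_periodic opprD addrNK.
have := goursat ab pi2 dv'; rewrite /boundary_int.
(* The two horizontal sides lie one period apart, hence they cancel in Goursat's theorem. *)
have -> : seg_int v (Complex a (pi *+ 2)) (Complex b (pi *+ 2)) =
    seg_int v (Complex a 0) (Complex b 0).
  rewrite /seg_int; congr (_ *: _).
    by apply/eqP; rewrite eq_complex /= !subrr !eqxx.
  congr dint; apply/funext => t; rewrite !seg_pointE !subrr !mulr0 addr0.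
  by rewrite -[pi *+ 2]add0r vper addr0.
rewrite subrr add0r => /subr0_eq segE.
have seg_pt (x t : R) : seg_point (Complex x 0) (Complex x (pi *+ 2)) t =
    Complex x (t * (pi *+ 2)).
  by rewrite seg_pointE subrr mulr0 addr0 subr0 add0r.
have cseg (x : R) : a <= x <= b ->
    continuous01 (fun t => v (seg_point (Complex x 0) (Complex x (pi *+ 2)) t)).
  by move=> xab; apply: (seg_continuous_in dv'); rewrite ?lexx ?pi2.
have len (x : R) : Complex x (pi *+ 2) - Complex x 0 = Complex 0 (pi *+ 2).
  by apply/eqP; rewrite eq_complex /= subrr subr0 !eqxx.
have aab : a <= a <= b by rewrite lexx.
have bab : a <= b <= b by rewrite lexx andbT.
have bound_b : nrm (seg_int v (Complex b 0) (Complex b (pi *+ 2))) <=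
    nrm (Complex 0 (pi *+ 2)) * (2 * M / r).
  rewrite -(len b); apply: (seg_int_bound (cseg b bab)) => t _; rewrite seg_pt.
  rewrite /v nrmZ nrm_cexp /= expRN lnK ?posrE// mulrC ler_wpM2r ?invr_ge0 ?(ltW r0)//.
  rewrite (le_trans (nrmB _ _))// [2 * M]mulrC mulr_natr mulr2n lerD//.
    by rewrite fM// nrm_cexp /= lnK ?posrE.
  by rewrite fM// nrm0 ltW.
have bound_a : nrm (seg_int v (Complex a 0) (Complex a (pi *+ 2)) - Complex 0 (pi *+ 2) *: l)
    <= nrm (Complex 0 (pi *+ 2)) * e.
  (* With slope [0], the affine correction subtracts the constant [l] under the integral. *)
  rewrite (seg_int_affine l 0 (cseg a aab)) !scaler0 !addr0 -scalerBl len addrK -(len a).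
  have cva (x y : R) : a <= x <= b -> 0 <= y <= pi *+ 2 ->
      exists l', cderiv (fun w => v w - (l + w *: 0)) (Complex x y) l'.
    by move=> xab /(dv' x y xab)[l']; exact: cderiv_affine.
  apply: seg_int_bound => [|t _].
    by apply: (seg_continuous_in cva); rewrite ?lexx ?pi2.
  rewrite seg_pt scaler0 addr0; set w := Complex a _.
  have w1 : cexp (- w) * cexp w = 1 by rewrite -cexpD addNr cexp0.
  have -> : v w - l = cexp (- w) *: (f (0 + cexp w) - f 0 - cexp w *: l).
    by rewrite add0r scalerBr scalerA w1 scale1r.
  have : nrm (cexp w) < d.
    rewrite nrm_cexp /= (@le_lt_trans _ _ (d / 2))//.
      by rewrite -[leRHS]lnK ?posrE ?divr_gt0// ler_expR ge_min lexx orbT.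
    by rewrite ltr_pdivrMr// ltr_pMr// ltr1n.
  by move=> /dP fd; rewrite nrmZ (le_trans (ler_wpM2l (nrm_ge0 _) fd))// mulrCA -nrmM w1 nrm1 mulr1.
have P0 : 0 < nrm (Complex 0 (pi *+ 2) : R[i]).
  by rewrite nrm_gt0 eq_complex /= eqxx /= mulrn_eq0 /= gt_eqF// pi_gt0.
rewrite -(ler_pM2l P0) -nrmZ mulrDr -[_ *: l](subKr (seg_int v (Complex a 0) (Complex a (pi *+ 2)))).
rewrite (le_trans (nrmB _ _))// lerD//.
by rewrite -segE.
Qed.

End Cauchy.

(** * The mean value inequality and second-order remainders in one variable *)

Section SecondOrder.
Context {R : realType} {F : completeNormedModType R[i]}.
Implicit Types (f : R[i]^o -> F) (z w h : R[i]) (l : F).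

(** A vector-valued function need not attain its mean slope, so the inequality is obtained by
    bisection: increments over adjacent intervals add up, and near each point the slope is at most
    [K + e]. *)
Lemma mean_value (G : R -> F) (K : R) :
  (forall t : R, 0 <= t <= 1 -> forall e : R, 0 < e -> exists2 d : R, 0 < d &
    forall s : R, 0 <= s <= 1 -> `|s - t| < d -> nrm (G s - G t) <= (K + e) * `|s - t|) ->
  nrm (G 1 - G 0) <= K.
Proof.
move=> dG; apply: le_eps => e e0.
have -> : K + e = (K + e) * (1 - 0) by rewrite subr0 mulr1.
apply: (@bisection R (fun a b => 0 <= a -> b <= 1 -> nrm (G b - G a) <= (K + e) * (b - a))) => //.
  move=> a b m ab mE P1 P2 a0 b1; have [am mb] : a <= m /\ m <= b by split; lra.
  rewrite (le_trans (nrm_tri (G m) _ _))// (le_trans (lerD (P2 _ _) (P1 _ _)))//.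
  - exact: le_trans am.
  - exact: le_trans b1.
  - by rewrite -mulrDr addrA subrK.
move=> x x01; have [d d0 dP] := dG x x01 e e0; exists d => // a b a0 /andP[ax xb] b1 bad _ _.
have a01 : 0 <= a <= 1 by rewrite a0 (le_trans ax)// (le_trans xb).
have b01 : 0 <= b <= 1 by rewrite b1 andbT (le_trans a0)// (le_trans ax).
rewrite (le_trans (nrm_tri (G x) _ _))// [nrm (G x - G a)]nrm_distC.
rewrite (le_trans (lerD (dP b b01 _) (dP a a01 _)))//.
- by rewrite ger0_norm ?subr_ge0//; move: ax bad; clear; lra.
- by rewrite distrC ger0_norm ?subr_ge0//; move: xb bad; clear; lra.
- by rewrite [`|a - x|]distrC !ger0_norm ?subr_ge0// -mulrDr addrA subrK.
Qed.

Lemma mean_value_cderiv f z h (K : R) :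
  (forall t : R, 0 <= t <= 1 -> exists2 l, cderiv f (z + t%:C%C * h) l & nrm l <= K) ->
  nrm (f (z + h) - f z) <= nrm h * K.
Proof.
move=> df; have -> : f (z + h) - f z = f (z + 1%:C%C * h) - f (z + 0%:C%C * h).
  by rewrite mul1r mul0r addr0.
apply: (@mean_value (fun t => f (z + t%:C%C * h))) => t t01 e e0.
have [l dl lK] := df t t01; have h1 : 0 < nrm h + 1 by rewrite ltr_wpDl ?nrm_ge0.
have [d d0 dP] := dl _ (divr_gt0 e0 h1); exists (d / (nrm h + 1)) => [|s _ st].
  exact: divr_gt0.
set k := (s - t)%:C%C * h.
have nk : nrm k = `|s - t| * nrm h by rewrite nrmM nrmC.
have -> : z + s%:C%C * h = z + t%:C%C * h + k by rewrite /k rmorphB /=; ring.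
have /dP kd : nrm k < d.
  rewrite nk (@le_lt_trans _ _ (`|s - t| * (nrm h + 1)))//.
    by rewrite ler_wpM2l// lerDl.
  by rewrite -ltr_pdivlMr.
rewrite -[_ - _](subrK (k *: l)) (le_trans (nrmD _ _))//.
rewrite (le_trans (lerD kd (lexx _)))// nrmZ addrC mulrDl lerD//.
  by rewrite nk [leRHS]mulrC -mulrA ler_wpM2l// ler_wpM2l ?nrm_ge0.
rewrite nk [`|_| * nrm h]mulrC mulrA ler_wpM2r// mulrAC ler_pdivrMr// ler_wpM2l ?(ltW e0)//.
by rewrite lerDl.
Qed.

Lemma cauchy_estimate f z (r M : R) l : 0 < r ->
  (forall w, nrm w <= r -> differentiable f (z + w : R[i]^o)) ->
  (forall w, nrm w <= r -> nrm (f (z + w)) <= M) ->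
  cderiv f z l -> nrm l <= 2 * M / r.
Proof.
move=> r0 df fM dl; apply: (@cauchy_estimate0 R F (fun w => f (z + w)) r M l r0 _ fM).
  by move=> w /df; exact: differentiable_shift.
by apply/cderiv_shift; rewrite addr0.
Qed.

Lemma cderivB f g z l k : cderiv f z l -> cderiv g z k ->
  cderiv (fun w => f w - g w) z (l - k).
Proof.
move=> df dg e e0; have e2 : 0 < e / 2 by rewrite divr_gt0.
have [d d0 dP] := df _ e2; have [c c0 cP] := dg _ e2.
exists (Num.min d c) => [|h]; first by rewrite lt_min d0.
rewrite lt_min => /andP[/dP hd /cP hc].
have -> : f (z + h) - g (z + h) - (f z - g z) - h *: (l - k) =
    (f (z + h) - f z - h *: l) - (g (z + h) - g z - h *: k).
  have sub4 (a b c' d' : F) : a - b - (c' - d') = a - c' - (b - d').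
    by rewrite opprD addrACA -opprD.
  by rewrite scalerBr [X in X - _ = _]sub4 [LHS]sub4.
by rewrite (le_trans (nrmB _ _))// [e]splitr mulrDl lerD.
Qed.

(** A second derivative is avoided by applying the Cauchy estimate to [f (k + z) - f z], which is of
    order [nrm k] by the mean value inequality. Each of the two Cauchy estimates has radius [r / 4]
    and contributes a factor [8 / r], hence the constant [64]. *)
Lemma taylor2 f (r M : R) l h : 0 < r ->
  (forall z, nrm z < r -> differentiable f (z : R[i]^o)) ->
  (forall z, nrm z < r -> nrm (f z) <= M) -> cderiv f 0 l -> nrm h <= r / 4 ->
  nrm (f h - f 0 - h *: l) <= 64 * M / r ^+ 2 * nrm h ^+ 2.
Proof.
move=> r0 df fM dl hr; have r4 : 0 < r / 4 by rewrite divr_gt0.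
have rr : r / 4 + r / 4 + r / 4 < r by lra.
have cd z : nrm z < r -> cderiv f z ('d f (z : R[i]^o) (1 : R[i]^o)).
  by move=> /df/differentiable_cderiv.
pose D z := 'd f (z : R[i]^o) (1 : R[i]^o).
have bound1 z : nrm z <= r / 4 + r / 4 -> nrm (D z) <= 2 * M / (r / 4).
  move=> zr; apply: (cauchy_estimate (f := f) (z := z) r4).
  - by move=> w wr; apply: df; rewrite (le_lt_trans (nrmD _ _))// (le_lt_trans (lerD zr wr)).
  - by move=> w wr; apply: fM; rewrite (le_lt_trans (nrmD _ _))// (le_lt_trans (lerD zr wr)).
  - by apply: cd; move: zr r0; clear; lra.
have convex_nrm (t : R) k : 0 <= t <= 1 -> nrm k <= r / 4 -> nrm (t%:C%C * k) <= r / 4.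
  move=> /andP[t0 t1] kr; rewrite nrmM nrmC ger0_norm// (le_trans _ kr)//.
  by rewrite ler_piMl ?nrm_ge0.
have bound2 k : nrm k <= r / 4 -> nrm (D k - D 0) <= 64 * M / r ^+ 2 * nrm k.
  move=> kr; have -> : 64 * M / r ^+ 2 * nrm k = 2 * (nrm k * (2 * M / (r / 4))) / (r / 4).
    by field; rewrite gt_eqF.
  apply: (cauchy_estimate (f := fun z => f (k + z) - f z) (z := 0) r4).
  - move=> w wr; rewrite add0r; apply: differentiableB; last first.
      by apply: df; move: wr r0; clear; lra.
    apply: differentiable_shift; apply: df.
    by rewrite (le_lt_trans (nrmD _ _))// (le_lt_trans (lerD kr wr))//; move: r0; clear; lra.
  - move=> w wr; rewrite add0r [k + w]addrC; apply: mean_value_cderiv => t t01.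
    have tk : nrm (w + t%:C%C * k) <= r / 4 + r / 4.
      by rewrite (le_trans (nrmD _ _))// lerD// convex_nrm.
    exists (D (w + t%:C%C * k)); last exact: bound1.
    by apply: cd; move: tk r0; clear; lra.
  - apply: cderivB; first by apply/cderiv_shift; rewrite addr0; apply: cd; lra.
    by apply: cd; rewrite nrm0.
have lD : l = D 0 by apply: (cderiv_unique dl); apply: cd; rewrite nrm0.
pose g (w : R[i]) := f w - w *: l.
have -> : f h - f 0 - h *: l = g (0 + h) - g 0.
  by rewrite /g scale0r subr0 add0r addrAC.
rewrite expr2 mulrA mulrC; apply: mean_value_cderiv => t t01; rewrite add0r.
have tr := convex_nrm t h t01 hr.
exists (D (t%:C%C * h) - l).
  apply: cderivB; first by apply: cd; move: tr r0; clear; lra.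
  move=> e e0; exists 1 => // k _; rewrite scalerDl [X in X - _ - _]addrC addrK subrr nrm0.
  by rewrite mulr_ge0 ?nrm_ge0// ltW.
have M0 : 0 <= M by apply: le_trans (fM 0 _); rewrite ?nrm_ge0 ?nrm0.
rewrite lD (le_trans (bound2 _ tr))// ler_wpM2l//.
  by rewrite !mulr_ge0// invr_ge0 exprn_ge0// ltW.
move: t01 => /andP[t0 t1]; rewrite nrmM nrmC ger0_norm// ler_piMl ?nrm_ge0//.
Qed.

End SecondOrder.

(** * Cauchy estimates for Frechet derivatives, along complex lines *)

Section Frechet.
Context {R : realType} {V : normedModType R[i]} {F : completeNormedModType R[i]}.
Implicit Types (f : V -> F) (z h : V).

Definition on_ball (z : V) (r : R) (P : V -> Prop) := forall h, nrm h < r -> P (z + h).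

Lemma line_cderiv f z h (a : R[i]) : differentiable f (z + a *: h) ->
  cderiv (fun b : R[i]^o => f (z + b *: h)) a ('d f (z + a *: h) h).
Proof.
move=> df; apply: (@deriv_at_line R V F f z h a ('d f (z + a *: h))).
  by move=> b x; rewrite linearZ.
exact: differentiable_deriv.
Qed.

Lemma frechet_bound f z h (r M : R) : 0 < r ->
  on_ball z r (fun w => differentiable f w) -> on_ball z r (fun w => nrm (f w) <= M) ->
  nrm ('d f z h) <= 4 * M / r * nrm h.
Proof.
move=> r0 df fM; have [->|h0] := eqVneq h 0; first by rewrite linear0 !nrm0 mulr0.
have nh : 0 < nrm h by rewrite nrm_gt0.
have -> : 4 * M / r * nrm h = 2 * M / (r / 2 / nrm h) by field; rewrite !gt_eqF.
(* The radius is halved because [cauchy_estimate] takes a closed disc inside the open ball; hence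
   [4] in place of [2]. *)
have r2 : 0 < r / 2 / nrm h by rewrite !divr_gt0.
have small (w : R[i]) : nrm w <= r / 2 / nrm h -> nrm (w *: h) < r.
  rewrite ler_pdivlMr// nrmZ => /le_lt_trans; apply.
  by rewrite ltr_pdivrMr// ltr_pMr// ltr1n.
apply: (cauchy_estimate (f := fun b : R[i]^o => f (z + b *: h)) (z := 0) r2).
- move=> w /small/df dw; rewrite add0r; apply: cderiv_differentiable.
  exact: line_cderiv.
- by move=> w /small/fM; rewrite add0r.
- by have := @line_cderiv f z h 0; rewrite scale0r addr0; apply;
    have := df 0; rewrite addr0 nrm0; apply.
Qed.

Lemma frechet_taylor2 f z h (r M : R) : 0 < r ->
  on_ball z r (fun w => differentiable f w) -> on_ball z r (fun w => nrm (f w) <= M) ->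
  nrm h <= r / 4 ->
  nrm (f (z + h) - f z - 'd f z h) <= 64 * M / r ^+ 2 * nrm h ^+ 2.
Proof.
move=> r0 df fM hr; have [->|h0] := eqVneq h 0.
  by rewrite linear0 addr0 subrr subr0 !nrm0 expr0n mulr0.
have nh : 0 < nrm h by rewrite nrm_gt0.
have r1 : 0 < r / nrm h by rewrite divr_gt0.
have small (w : R[i]) : nrm w < r / nrm h -> nrm (w *: h) < r.
  by rewrite ltr_pdivlMr// nrmZ.
have := @taylor2 R F (fun b : R[i]^o => f (z + b *: h)) (r / nrm h) M ('d f z h) 1 r1.
rewrite !scale1r scale0r addr0 nrm1 expr1n mulr1.
have -> : 64 * M / (r / nrm h) ^+ 2 = 64 * M / r ^+ 2 * nrm h ^+ 2.
  by field; rewrite !gt_eqF.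
apply.
- move=> w /small/df dw; apply: cderiv_differentiable; exact: line_cderiv.
- by move=> w /small/fM.
- have := @line_cderiv f z h 0; rewrite scale0r addr0; apply.
  by have := df 0; rewrite addr0 nrm0; apply.
- by rewrite mulrAC ler_pdivlMr// mul1r.
Qed.

End Frechet.

(** * Uniform limits *)

Section UniformLimits.
Context {R : realType} {V : normedModType R[i]}.

Lemma quadratic_differentiable (F : normedModType R[i]) (f L : V -> F) (z : V)
    (r C K : R) : 0 < r -> linear L -> (forall h, nrm (L h) <= K * nrm h) ->
  (forall h, nrm h <= r -> nrm (f (z + h) - f z - L h) <= C * nrm h ^+ 2) ->
  differentiable f z.
Proof.
move=> r0 lL bL H; apply: (deriv_differentiable lL bL) => e e0.
have C1 : 0 < `|C| + 1 by rewrite ltr_wpDl.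
exists (Num.min r (e / (`|C| + 1))) => [|h]; first by rewrite lt_min r0 divr_gt0.
rewrite lt_min ltr_pdivlMr// => /andP[/ltW/H hr he].
rewrite (le_trans hr)// expr2 mulrA ler_wpM2r ?nrm_ge0// (le_trans _ (ltW he))//.
by rewrite mulrC ler_wpM2l ?nrm_ge0// (le_trans (ler_norm _))// lerDl.
Qed.

(** Weierstrass's theorem at the centre of a ball. The approximants share one bound, so their
    remainders share one quadratic constant, which survives the limit together with the limit of
    their derivatives. *)
Lemma uniform_limit_differentiable (F : completeNormedModType R[i]) (f : V -> F)
    (z : V) (r M : R) : 0 < r -> on_ball z r (fun w => nrm (f w) <= M) ->
  (forall e : R, 0 < e -> exists2 g : V -> F, on_ball z r (fun w => differentiable g w) &
    on_ball z r (fun w => nrm (f w - g w) <= e)) ->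
  differentiable f z.
Proof.
move=> r0 fM app; pose eps n : R := 2^-1 ^+ n.
have eps0 n : 0 < eps n by rewrite exprn_gt0.
have eps1 n : eps n <= 1 by rewrite exprn_ile1// invf_le1 ?ler1n.
have epsm n p : (n <= p)%N -> eps p <= eps n by move=> np; rewrite ler_wiXn2l// invf_le1 ?ler1n.
have /choice[g gP] n : exists g : V -> F, on_ball z r (fun w => differentiable g w) /\
    on_ball z r (fun w => nrm (f w - g w) <= eps n).
  by have [g dg fg] := app (eps n) (eps0 n); exists g.
have dg n : on_ball z r (fun w => differentiable (g n) w) by case: (gP n).
have fg n : on_ball z r (fun w => nrm (f w - g n w) <= eps n) by case: (gP n).
have dgz n : differentiable (g n) z by have := dg n 0; rewrite addr0 nrm0; apply.
have gM n : on_ball z r (fun w => nrm (g n w) <= M + 1).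
  move=> h hr; rewrite -[g n _](subKr (f (z + h))) (le_trans (nrmB _ _))//.
  by rewrite lerD ?fM// (le_trans (fg n h hr)).
have M1 : 0 <= M + 1 by apply: le_trans (gM 0%N 0 _); rewrite ?nrm_ge0 ?nrm0.
pose L n h := 'd (g n) z h.
(* The first-order estimate is applied to [g n - g p], which is at most [2 * eps n] on the ball. *)
have Lcauchy n p h : (n <= p)%N -> nrm (L n h - L p h) <= 8 / r * nrm h * eps n.
  move=> np; have -> : L n h - L p h = 'd (fun w => g n w - g p w) z h.
    by rewrite [in RHS](@diffB _ _ _ (g n) (g p) z).
  have -> : 8 / r * nrm h * eps n = 4 * (2 * eps n) / r * nrm h.
    by field; rewrite gt_eqF.
  apply: frechet_bound => // k kr; first by apply: differentiableB; apply: dg.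
  rewrite (le_trans (nrm_tri (f (z + k)) _ _))// nrm_distC [2 * _]mulrC mulr_natr mulr2n.
  by rewrite lerD ?fg// (le_trans (fg p k kr))// epsm.
have Clim h : exists l, forall e : R, 0 < e -> exists n0, forall n, (n0 <= n)%N ->
    nrm (L n h - l) <= e.
  apply: complete_nrm => e e0.
  have [n0 n0P] := half_pow_small (8 / r * nrm h) (divr_gt0 e0 (ltr0Sn _ 1)).
  have n0P' n : (n0 <= n)%N -> nrm (L n0 h - L n h) <= e / 2.
    by move=> n0n; rewrite (le_trans (Lcauchy _ _ _ n0n))// ltW// n0P.
  exists n0 => n p nn np; rewrite (le_trans (nrm_tri (L n0 h) _ _))//.
  by rewrite [e]splitr; apply: lerD; [rewrite nrm_distC|]; exact: n0P'.
have [L' L'P] := choice Clim.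
have Llim h n : nrm (L n h - L' h) <= 8 / r * nrm h * eps n.
  apply: le_eps => e e0; have [n0 n0P] := L'P h e e0.
  rewrite (le_trans (nrm_tri (L (maxn n n0) h) _ _))//.
  by rewrite lerD ?Lcauchy ?leq_maxl// n0P// leq_maxr.
have small (c e : R) : 0 < e -> exists n, c * eps n <= e.
  by move=> /(half_pow_small c)[n nP]; exists n; rewrite ltW// nP.
apply: (@quadratic_differentiable _ f L' z (r / 4) (64 * (M + 1) / r ^+ 2) (4 * (M + 1) / r)).
- exact: divr_gt0.
- move=> a x y; apply/subr0_eq/nrm_le0/le_eps => e e0; rewrite add0r.
  have [n nP] := small (8 / r * nrm (a *: x + y) + nrm a * (8 / r * nrm x) + 8 / r * nrm y) e e0.
  have -> : L' (a *: x + y) - (a *: L' x + L' y) =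
      a *: (L n x - L' x) + (L n y - L' y) - (L n (a *: x + y) - L' (a *: x + y)).
    have -> : L n (a *: x + y) = a *: L n x + L n y by rewrite /L linearP.
    rewrite opprB scalerBr; move: (L' (a *: x + y)) (a *: L' x) (L' y) (a *: L n x) (L n y).
    move=> Z X Y X' Y'.
    by rewrite [X' - X + _]addrACA -opprD [RHS]addrC subrKA.
  rewrite (le_trans (nrmB _ _))// (le_trans (lerD (nrmD _ _) (lexx _)))// nrmZ.
  rewrite (le_trans (lerD (lerD (ler_wpM2l (nrm_ge0 _) (Llim x n)) (Llim y n)) (Llim _ n)))//.
  by apply: le_trans nP; rewrite le_eqVlt; apply/orP; left; apply/eqP; ring.
- move=> h; apply: le_eps => e e0; have [n nP] := small (8 / r * nrm h) e e0.
  rewrite -[L' h](subKr (L n h)) (le_trans (nrmB _ _))// lerD//.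
    exact: frechet_bound.
  exact: le_trans (Llim h n) nP.
- move=> h hr; apply: le_eps => e e0.
  have [n nP] := small (2 + 8 / r * nrm h) e e0.
  have hr' : nrm h < r by rewrite (le_lt_trans hr)// ltr_pdivrMr// ltr_pMr// ltr1n.
  have zr : nrm (f z - g n z) <= eps n by have := fg n 0; rewrite addr0 nrm0; apply.
  have -> : f (z + h) - f z - L' h = (g n (z + h) - g n z - L n h) +
     ((f (z + h) - g n (z + h)) - (f z - g n z) + (L n h - L' h)).
    set A := f (z + h); set B := g n (z + h); set D := f z; set E := g n z.
    have sub4 (a b c d : F) : a - b - (c - d) = a - c - (b - d) by rewrite opprD addrACA -opprD.
    by rewrite sub4 addrCA !subrKA.
  rewrite (le_trans (nrmD _ _))// lerD//; first exact: frechet_taylor2.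
  apply: le_trans nP; rewrite (le_trans (nrmD _ _))// mulrDl lerD//.
  rewrite (le_trans (nrmB _ _))// [2 * _]mulrC mulr_natr mulr2n lerD//.
  exact: fg.
Qed.

Lemma diff_linear (F : normedModType R[i]) (f g : V -> F) (z h : V) (a : R[i]) :
  differentiable f z -> differentiable g z ->
  'd (fun w => a *: f w + g w) z h = a *: 'd f z h + 'd g z h.
Proof.
move=> df dg; have daf := differentiableZ a df.
have E1 : 'd (a *: f + g) z h = 'd (a *: f) z h + 'd g z h.
  exact: (congr1 (fun k : V -> F => k h) (diffD daf dg)).
have E2 : 'd (a *: f) z h = a *: 'd f z h.
  exact: (congr1 (fun k : V -> F => k h) (diffZ a df)).
apply: etrans E1 _; exact: (congr1 (fun t => t + 'd g z h) E2).
Qed.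

(** The pointwise derivatives [D h x] are linear in [x] and bounded by a multiple of [nrm x], so
    they form an operator. For [x] in the unit ball the remainders have a common quadratic bound,
    which is a bound in operator norm. *)
Lemma Hom_differentiable (E F : completeNormedModType R[i]) (Phi : V -> Defs.Hom E F)
    (z : V) (r M : R) : 0 < r ->
  (forall x, on_ball z r (fun w => nrm (Phi w x) <= M * nrm x)) ->
  (forall x, on_ball z r (fun w => differentiable (fun w => Phi w x) w)) ->
  differentiable Phi z.
Proof.
move=> r0 PM dP.
have dz x : differentiable (fun w => Phi w x) z.
  by have := dP x 0; rewrite addr0 nrm0; apply.
pose D h x : F := 'd (fun w => Phi w x) z h.
have DM h x : nrm (D h x) <= 4 * M / r * nrm h * nrm x.
  rewrite (le_trans (frechet_bound h r0 (dP x) (PM x)))//.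
  by rewrite le_eqVlt; apply/orP; left; apply/eqP; ring.
have Dlin h : linear (D h).
  move=> a x y; rewrite /D.
  have -> : (fun w => Phi w (a *: x + y)) = (fun w => a *: Phi w x + Phi w y).
    by apply/funext => w; rewrite linearP.
  exact: diff_linear.
have Dcont h : D h \in continuous_linear.
  apply/asboolP; split=> //.
  pose l : {linear E -> F} := HB.pack (D h) (GRing.isLinear.Build _ _ _ _ (D h) (Dlin h)).
  rewrite -[D h]/(l : E -> F); apply/linear_bounded_continuous/linear_boundedP.
  near=> k => x /=; rewrite (@le_trans _ _ ((4 * M / r * nrm h)%:C%C * `|x|))//.
    by rewrite !nrmE -rmorphM lecR DM.
  rewrite ler_wpM2r//; near: k; apply: nbhs_pinfty_ge.
  by apply/complex_realP; eexists.
pose L h : Defs.Hom E F := Sub (D h) (Dcont h).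
have opb (f : Defs.Hom E F) (K : R) : (forall x, nrm x <= 1 -> nrm (f x) <= K) -> nrm f <= K.
  move=> fK; rewrite -lecR -nrmE; apply: opnorm_le => x.
  by rewrite nrmE (_ : 1 = 1%:C%C)// lecR => /fK; rewrite -lecR -nrmE.
have x1 (K : R) (x : E) : 0 <= K -> nrm x <= 1 -> K * nrm x <= K.
  by move=> K0 x1; rewrite ler_piMr.
have M0 : 0 <= `|M| by [].
apply: (@quadratic_differentiable (Defs.Hom E F) Phi L z (r / 4) (64 * `|M| / r ^+ 2) (4 * `|M| / r)).
- exact: divr_gt0.
- move=> a x y; apply/val_inj/funext => u.
  apply: etrans (linearP ('d (fun w => Phi w u) z) a x y) _; symmetry.
  exact: (etrans (HomD (a *: L x) (L y) u) (congr1 (fun t => t + L y u) (HomZ a (L x) u))).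
- move=> h; apply: opb => x xle.
  rewrite (le_trans (DM h x))// (@le_trans _ _ (4 * `|M| / r * nrm h * nrm x))//.
    by rewrite !ler_wpM2r ?nrm_ge0 ?invr_ge0 ?(ltW r0)// ler_wpM2l// ler_norm.
  by apply: x1 => //; rewrite !mulr_ge0 ?nrm_ge0 ?invr_ge0 ?(ltW r0).
- move=> h hr; apply: opb => x xle.
  have -> : (Phi (z + h) - Phi z - L h : Defs.Hom E F) x = Phi (z + h) x - Phi z x - D h x by [].
  rewrite (le_trans (frechet_taylor2 r0 (dP x) (PM x) hr))//.
  rewrite ler_wpM2r ?exprn_ge0 ?nrm_ge0// ler_wpM2r ?invr_ge0 ?exprn_ge0 ?(ltW r0)//.
  rewrite ler_wpM2l// (@le_trans _ _ (`|M| * nrm x))// ?x1//.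
  by rewrite ler_wpM2r ?nrm_ge0// ler_norm.
Unshelve. all: by end_near. Qed.

End UniformLimits.

(** * Hadamard's lemma *)

Section Hadamard.
Context {R : realType} {F : completeNormedModType R[i]}.

Section Partial.
Context {V : normedModType R[i]}.
Implicit Types (f : V -> F) (z h d : V).

Lemma on_ball_shift (P : V -> Prop) z h (r s : R) : nrm h + s <= r ->
  on_ball z r P -> on_ball (z + h) s P.
Proof.
move=> hs Pz k ks; rewrite -addrA; apply: Pz.
by rewrite (le_lt_trans (nrmD _ _))// (lt_le_trans _ hs)// ltrD2l.
Qed.

(** A directional derivative is the uniform limit of difference quotients with step [t], because the
    second-order remainder makes their error at most [t * C]. *)
Lemma partial_differentiable f z d (r M : R) : 0 < r ->
  on_ball z r (fun w => differentiable f w) -> on_ball z r (fun w => nrm (f w) <= M) ->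
  differentiable (fun w => 'd f w d) z.
Proof.
move=> r0 df fM; have r2 : 0 < r / 2 by rewrite divr_gt0.
have dfs h : nrm h < r / 2 -> on_ball (z + h) (r / 2) (fun w => differentiable f w).
  by move=> hr; apply: on_ball_shift df; rewrite [leRHS]splitr lerD2r ltW.
have fMs h : nrm h < r / 2 -> on_ball (z + h) (r / 2) (fun w => nrm (f w) <= M).
  by move=> hr; apply: on_ball_shift fM; rewrite [leRHS]splitr lerD2r ltW.
apply: (@uniform_limit_differentiable _ _ _ _ z (r / 2) (4 * M / (r / 2) * nrm d)) => //.
  by move=> h hr; apply: frechet_bound (dfs h hr) (fMs h hr).
move=> e e0; pose C := 64 * M / (r / 2) ^+ 2 * nrm d ^+ 2.
have d1 : 0 < nrm d + 1 by rewrite ltr_wpDl ?nrm_ge0.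
have C1 : 0 < `|C| + 1 by rewrite ltr_wpDl.
(* The first entry keeps [t d] within reach of [frechet_taylor2], the second makes the error [t * C]
   at most [e]. *)
pose t := Num.min (r / 2 / 4 / (nrm d + 1)) (e / (`|C| + 1)).
have t0 : 0 < t by rewrite lt_min !divr_gt0.
have nt : nrm (t%:C%C : R[i]) = t by rewrite nrmC gtr0_norm.
have td : nrm (t%:C%C *: d) <= r / 2 / 4.
  rewrite nrmZ nt (@le_trans _ _ (t * (nrm d + 1)))//.
    by rewrite ler_wpM2l ?(ltW t0)// lerDl.
  by rewrite -ler_pdivlMr// ge_min lexx.
have tr : nrm (t%:C%C *: d) < r / 2.
  by rewrite (le_lt_trans td)// ltr_pdivrMr// ltr_pMr// ltr1n.
exists (fun w => (t%:C%C)^-1 *: (f (w + t%:C%C *: d) - f w)) => h hr.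
  apply: differentiableZ; apply: differentiableB.
    apply: (@differentiable_comp _ _ _ _ (fun w => w + t%:C%C *: d) f).
      by apply: differentiableD => //; exact: differentiable_cst.
    by have := dfs h hr _ tr.
  by have := dfs h hr 0; rewrite addr0 nrm0; apply.
have t1 : (t%:C%C : R[i]) != 0 by rewrite -nrm_gt0 nt.
have -> : 'd f (z + h) d - (t%:C%C)^-1 *: (f (z + h + t%:C%C *: d) - f (z + h)) =
  - ((t%:C%C)^-1 *: (f (z + h + t%:C%C *: d) - f (z + h) - 'd f (z + h) (t%:C%C *: d))).
  have -> : 'd f (z + h) (t%:C%C *: d) = t%:C%C *: 'd f (z + h) d by exact: linearZ.
  by rewrite [in RHS]scalerBr scalerA mulVf// scale1r opprB.
rewrite nrmN nrmZ nrmV nt mulrC ler_pdivrMr//.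
rewrite (le_trans (frechet_taylor2 r2 (dfs h hr) (fMs h hr) td))// nrmZ nt [(t * nrm d) ^+ 2]exprMn.
have -> : 64 * M / (r / 2) ^+ 2 * (t ^+ 2 * nrm d ^+ 2) = (t * C) * t.
  by rewrite /C; ring.
rewrite ler_wpM2r ?(ltW t0)//.
rewrite (@le_trans _ _ (t * (`|C| + 1)))//.
  by rewrite ler_wpM2l ?(ltW t0)// (le_trans (ler_norm _))// lerDl.
by rewrite -ler_pdivlMr// ge_min lexx orbT.
Qed.

Lemma differentiable_dyadic_sum n (H : R -> V -> F) (w : V) :
  (forall t : R, 0 <= t <= 1 -> differentiable (H t) w) ->
  differentiable (fun v => dyadic_sum n (fun t => H t v)) w.
Proof.
elim: n H => [|n IH] H dH /=; first by apply: dH; rewrite lexx ler01.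
apply: differentiableZ; apply: differentiableD; apply: (IH (fun t => H _)) => t t01.
  by apply: dH; lra.
by apply: dH; lra.
Qed.

Lemma differentiable_bounded f z : (\forall w \near z, differentiable f w) ->
  exists r M : R, [/\ 0 < r, on_ball z r (fun w => differentiable f w) &
    on_ball z r (fun w => nrm (f w) <= M)].
Proof.
move=> /nrm_nearP[r r0 rP].
have dz : differentiable f z by have := rP 0; rewrite addr0 nrm0; apply.
have [K _ KP] := diff_bounded dz.
have [d d0 dP] := deriv_at_continuous KP (differentiable_deriv dz) ltr01.
exists (Num.min r d), (1 + nrm (f z)); split; first by rewrite lt_min r0.
  by move=> h; rewrite lt_min => /andP[/rP].
move=> h; rewrite lt_min => /andP[_ /dP hd].
by rewrite -[f (z + h)](subrK (f z)) (le_trans (nrmD _ _))// lerD2r.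
Qed.

(** These means over segments become the quotients in Hadamard's lemma. They are uniform limits of
    dyadic sums since [g] is Lipschitz along all the segments with one constant. *)
Lemma segment_mean_differentiable (g : V -> F) z (r K : R) : 0 < r ->
  on_ball z r (fun w => differentiable g w) -> on_ball z r (fun w => nrm (g w) <= K) ->
  (forall h, nrm h < r / 2 -> continuous01 (fun t => g (z + t%:C%C *: h))) /\
  on_ball z (r / 2) (fun w =>
    differentiable (fun w => dint (fun t => g (z + t%:C%C *: (w - z)))) w).
Proof.
move=> r0 dg gK; have r2 : 0 < r / 2 by rewrite divr_gt0.
have r8 : 0 < r / 2 / 4 by rewrite divr_gt0.
have K0 : 0 <= K by apply: le_trans (gK 0 _); rewrite ?nrm_ge0 ?nrm0.
have half h : nrm h < r / 2 -> nrm h + r / 2 <= r.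
  by move=> hr; rewrite [leRHS]splitr lerD2r ltW.
(* The derivative bound plus the quadratic remainder over steps of at most [r / 2 / 4], multiplied
   by [r / 2], which bounds the length of the segments. *)
pose C := (4 * K / (r / 2) + 64 * K / (r / 2) ^+ 2 * (r / 2 / 4)) * (r / 2).
have C0 : 0 <= C.
  by rewrite mulr_ge0 ?(ltW r2)// addr_ge0// !mulr_ge0// ?invr_ge0 ?exprn_ge0// ltW.
have lip h k : nrm h < r / 2 -> nrm k <= r / 2 / 4 ->
    nrm (g (z + h + k) - g (z + h)) <= C / (r / 2) * nrm k.
  move=> hr kr; have dgh := on_ball_shift (half h hr) dg.
  have gKh := on_ball_shift (half h hr) gK.
  rewrite -[_ - _](subrK ('d g (z + h) k)) (le_trans (nrmD _ _))//.
  rewrite (le_trans (lerD (frechet_taylor2 r2 dgh gKh kr) (frechet_bound k r2 dgh gKh)))//.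
  rewrite /C mulfK ?gt_eqF// [leRHS]mulrDl [leLHS]addrC lerD2l [nrm k ^+ 2]expr2 [leLHS]mulrA.
  by rewrite ler_wpM2r ?nrm_ge0// ler_wpM2l// !mulr_ge0 ?invr_ge0 ?exprn_ge0 ?(ltW r2).
have th (t : R) h : 0 <= t <= 1 -> nrm h < r / 2 -> nrm (t%:C%C *: h) < r / 2.
  move=> /andP[t0 t1] hr; rewrite nrmZ nrmC ger0_norm// (le_lt_trans _ hr)//.
  by rewrite ler_piMl ?nrm_ge0.
have lip01 h (s t : R) : nrm h < r / 2 -> 0 <= t <= 1 -> `|s - t| <= 1 / 4 ->
    nrm (g (z + s%:C%C *: h) - g (z + t%:C%C *: h)) <= C * `|s - t|.
  move=> hr t01 st.
  have -> : z + s%:C%C *: h = z + t%:C%C *: h + (s - t)%:C%C *: h.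
    by rewrite -addrA -scalerDl -rmorphD /= subrKC.
  apply: (le_trans (lip _ _ (th t h t01 hr) _)).
    by rewrite nrmZ nrmC mulrC ler_pM ?nrm_ge0 ?(ltW hr)// -[4^-1]mul1r.
  rewrite nrmZ nrmC -mulrA ler_wpM2l// mulrC ler_pdivrMr//.
  by rewrite ler_wpM2l// ltW.
have cont h : nrm h < r / 2 -> continuous01 (fun t => g (z + t%:C%C *: h)).
  move=> hr t t01 e e0; have C1 : 0 < C + 1 by rewrite ltr_wpDl.
  exists (Num.min (1 / 4) (e / (C + 1))) => [|s s01]; first by rewrite lt_min !divr_gt0.
  rewrite lt_min => /andP[/ltW st1]; rewrite ltr_pdivlMr// => /ltW st2.
  rewrite (le_trans (lip01 h s t hr t01 st1))// (le_trans _ st2)//.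
  by rewrite mulrC ler_wpM2l// lerDl.
(* From level [2] on, parameters differ by at most [1 / 4], which is the range of [lip01]. *)
have osc h n : nrm h < r / 2 -> (2 <= n)%N ->
    oscillation (fun t => g (z + t%:C%C *: h)) n (C * 2^-1 ^+ n).
  move=> hr n2 s t s01 t01 st.
  apply: (le_trans (lip01 h s t hr t01 _)); last by rewrite ler_wpM2l.
  apply: (le_trans st); have -> : 1 / 4 = 2^-1 ^+ 2 :> R by field.
  by rewrite ler_wiXn2l// invf_le1 ?ler1n.
split=> // h hr.
have s0 : 0 < r / 2 - nrm h by rewrite subr_gt0.
have inside k : nrm k < r / 2 - nrm h -> nrm (h + k) < r / 2.
  by rewrite ltrBrDl => /(le_lt_trans (nrmD _ _)).
have zhk k : z + h + k - z = h + k by rewrite -[z + h + k]addrA [LHS]addrC addKr.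
apply: (@uniform_limit_differentiable _ _ _ _ (z + h) (r / 2 - nrm h) K) => //.
  move=> k /inside kr; rewrite zhk; apply: is_int_bound (dintP (cont _ kr)) => t t01.
  by apply: gK; rewrite (lt_trans (th _ _ t01 kr))// ltr_pdivrMr// ltr_pMr// ltr1n.
move=> e e0; have [n nP] := half_pow_small C e0; pose p := maxn n 2.
exists (fun w => dyadic_sum p (fun t => g (z + t%:C%C *: (w - z)))) => k /inside kr.
  apply: differentiable_dyadic_sum => t t01.
  apply: (@differentiable_comp _ _ _ _ (fun w => z + t%:C%C *: (w - z)) g).
    apply: differentiableD; first exact: differentiable_cst.
    apply: differentiableZ; apply: differentiableB => //; exact: differentiable_cst.
  rewrite zhk; apply: dg.
  by rewrite (lt_trans (th _ _ t01 kr))// ltr_pdivrMr// ltr_pMr// ltr1n.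
rewrite zhk nrm_distC.
rewrite (le_trans (is_int_osc (osc _ p kr (leq_maxr _ _)) (dintP (cont _ kr))))//.
by rewrite ltW// nP// leq_maxl.
Qed.

End Partial.
End Hadamard.

Lemma mx_norm_coord (K : numDomainType) (m n : nat) (x : 'M[K]_(m, n)) i j :
  `|x i j| <= mx_norm x.
Proof.
rewrite mx_normE -[leLHS]nngE num_le.
exact: (le_bigmax _ (fun ij : 'I_m * 'I_n => `|x ij.1 ij.2|%:nng) (i, j)).
Qed.

Lemma nrm_scale_le (R : realType) (V : normedModType R[i]) (h : V) (t : R) :
  0 <= t <= 1 -> nrm (t%:C%C *: h) <= nrm h.
Proof.
by move=> /andP[t0 t1]; rewrite nrmZ nrmC ger0_norm// ler_piMl ?nrm_ge0.
Qed.

(** * Coordinate functions and the Hadamard decomposition *)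

Section Coordinates.
Context {R : realType} {m : nat}.
Implicit Types (z h w : Cn R m) (i : 'I_m).

Definition coordinate i w : R[i] := (w : 'rV[R[i]]_m) ord0 i.

Lemma nrm_coord i w : nrm (coordinate i w) <= nrm w.
Proof.
rewrite -lecR -!nrmE; exact: (mx_norm_coord (w : 'rV_m) ord0 i).
Qed.

Lemma nrm_coord_max w : w != 0 -> exists i, nrm (coordinate i w) = nrm w.
Proof.
move=> w0; have : mx_norm (w : 'rV_m) != 0 by rewrite -[mx_norm _]/(`|w|) normr_eq0.
move=> /mx_norm_neq0[[a i] /= H]; exists i; apply/complexI; rewrite -!nrmE.
by rewrite -[RHS]/(mx_norm _) H /coordinate (ord1 a).
Qed.

Lemma coordD i w h : coordinate i (w + h) = coordinate i w + coordinate i h.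
Proof. by rewrite /coordinate mxE. Qed.

Lemma coord_differentiable i w : differentiable (coordinate i : Cn R m -> R[i]^o) w.
Proof.
apply: (@deriv_differentiable _ _ _ _ _ (coordinate i : Cn R m -> R[i]^o) 1).
- by move=> a x y; rewrite /coordinate !mxE.
- by move=> h; rewrite mul1r nrm_coord.
move=> e e0; exists 1 => // h _.
have -> : (coordinate i : Cn R m -> R[i]^o) (w + h) - (coordinate i : Cn R m -> R[i]^o) w - (coordinate i : Cn R m -> R[i]^o) h = 0.
  by rewrite coordD [coordinate i w + _]addrC addrK subrr.
by rewrite nrm0 mulr_ge0 ?nrm_ge0// ltW.
Qed.

Lemma linear_coord (F : lmodType R[i]) (L : {linear Cn R m -> F}) h :
  L h = \sum_i coordinate i h *: L (delta_mx ord0 i : 'rV_m).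
Proof.
have {1}-> : h = \sum_i coordinate i h *: (delta_mx ord0 i : 'rV_m).
  by rewrite [LHS]row_sum_delta.
by rewrite linear_sum; apply: eq_bigr => i _; rewrite linearZ.
Qed.

(** The increment [f (z + h) - f z] is the integral of ['d f (z + t h) h] over [[0, 1]]; expanding
    [h] in coordinates under the integral gives the [q i] as means of partial derivatives. *)
Lemma hadamard (F : completeNormedModType R[i]) (f : Cn R m -> F) z :
  (\forall w \near z, differentiable f w) ->
  exists (r : R) (q : 'I_m -> Cn R m -> F), [/\ 0 < r,
    forall i, on_ball z r (fun w => differentiable (q i) w) &
    forall h, nrm h < r -> f (z + h) = f z + \sum_i coordinate i h *: q i (z + h)].
Proof.
move=> /differentiable_bounded[r [M [r0 df fM]]].
have r2 : 0 < r / 2 by rewrite divr_gt0.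
have half h : nrm h < r / 2 -> nrm h + r / 2 <= r.
  by move=> hr; rewrite [leRHS]splitr lerD2r ltW.
have r24 : r / 2 / 2 < r / 2 by rewrite ltr_pdivrMr// ltr_pMr// ltr1n.
pose dl i : Cn R m := delta_mx ord0 i.
pose G i w := 'd f w (dl i).
have dG i : on_ball z (r / 2) (fun w => differentiable (G i) w).
  move=> h hr; apply: (partial_differentiable _ r2).
    exact: on_ball_shift (half h hr) df.
  exact: on_ball_shift (half h hr) fM.
have GK i : on_ball z (r / 2) (fun w => nrm (G i w) <= 4 * M / (r / 2) * nrm (dl i)).
  move=> h hr; apply: (frechet_bound _ r2).
    exact: on_ball_shift (half h hr) df.
  exact: on_ball_shift (half h hr) fM.
have cG i := proj1 (segment_mean_differentiable r2 (dG i) (GK i)).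
have dq i := proj2 (segment_mean_differentiable r2 (dG i) (GK i)).
(* One halving leaves room for the partial derivatives; the quarter is the range of the second-order
   estimate along the segment. *)
exists (r / 2 / 4), (fun i w => dint (fun t => G i (z + t%:C%C *: (w - z)))); split.
- by rewrite !divr_gt0.
- move=> i h hr; apply: dq; rewrite (lt_trans hr)// ltr_pM2l// ltf_pV2 ?posrE// ltr_nat//.
move=> h hr.
have hr' : nrm h < r / 2 / 2 by rewrite (lt_trans hr)// ltr_pM2l// ltf_pV2 ?posrE// ltr_nat.
have zh : z + h - z = h by rewrite addrC addKr.
pose J i := dint (fun t => G i (z + t%:C%C *: h)).
suff sumE : \sum_i coordinate i h *: J i = f (z + h) - f z.
  apply: (@etrans _ _ (f z + \sum_i coordinate i h *: J i)); first by rewrite sumE subrKC.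
  have JE i : J i = dint (fun t => G i (z + t%:C%C *: (z + h - z))) by rewrite zh.
  apply: (congr1 (fun t => f z + t)).
  exact: (eq_bigr _ (fun i _ => congr1 (fun t => coordinate i h *: t) (JE i))).
have I0 i : is_int (fun t : R => coordinate i h *: G i (z + t%:C%C *: h)) (coordinate i h *: J i).
  exact: (is_intZ _ (dintP (cG i h hr'))).
have I1 := is_int_sum I0.
apply: (is_int_unique I1).
have -> : (fun t : R => \sum_i coordinate i h *: G i (z + t%:C%C *: h)) =
    (fun t => 'd f (z + t%:C%C *: h) h).
  by apply/funext => t; rewrite -(linear_coord ('d f (z + t%:C%C *: h)) h).
have -> : f (z + h) - f z = f (z + 1%:C%C *: h) - f (z + 0%:C%C *: h).
  by rewrite scale1r scale0r addr0.
apply: (@is_int_ftc R F (fun t => f (z + t%:C%C *: h)) _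
  (64 * M / (r / 2) ^+ 2 * nrm h ^+ 2)) => t s t0 s0 ts.
have sE : z + (t + s)%:C%C *: h = z + t%:C%C *: h + s%:C%C *: h.
  by rewrite rmorphD /= scalerDl addrA.
have [t1 s1] : 0 <= t <= 1 /\ 0 <= s <= 1 by move: t0 s0 ts; clear; lra.
have tr : nrm (t%:C%C *: h) < r / 2.
  apply: (le_lt_trans (nrm_scale_le h t1)); exact: (lt_trans hr' r24).
have sr : nrm (s%:C%C *: h) <= r / 2 / 4.
  by apply: (le_trans (nrm_scale_le h s1)); exact: ltW.
have := frechet_taylor2 r2 (on_ball_shift (half _ tr) df) (on_ball_shift (half _ tr) fM) sr.
rewrite sE nrmZ nrmC (ger0_norm s0).
have -> : 'd f (z + t%:C%C *: h) (s%:C%C *: h) = s%:C%C *: 'd f (z + t%:C%C *: h) h.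
  exact: linearZ.
move=> /le_trans; apply.
by rewrite le_eqVlt; apply/orP; left; apply/eqP; ring.
Qed.

End Coordinates.

(** * Boundedness from Newton series *)

Section NewtonSeries.
Context {R : realType} {m : nat} {E : completeNormedModType R[i]} {F : normedModType R[i]}.
Local Notation V := (Cn R m).

(** Since [2 b = (a + b) - (a - b)], both signs cannot fail. In a Newton step this prevents the new
    term from being cancelled by the partial sum [a]. *)
Lemma nrm_sign (a b : F) (c : R) : c <= nrm b ->
  c <= nrm (a + b) \/ c <= nrm (a - b).
Proof.
move=> cb; have [h|h] := leP c (nrm (a + b)); first by left.
right; rewrite leNgt; apply/negP => h'.
have : nrm ((a + b) - (a - b)) < c + c.
  by rewrite (le_lt_trans (nrmB _ _))// ltrD.
rewrite opprD opprK addrACA subrr add0r -mulr2n -scaler_nat nrmZ.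
rewrite -[2%:R](rmorph_nat (real_complex R)) nrmC ger0_norm//.
by move: cb; clear; lra.
Qed.

Lemma telescope_bound (s : nat -> E) :
  (forall n, nrm (s n.+1 - s n) <= 2^-1 ^+ n) ->
  exists l, forall n, nrm (s n - l) <= 2 * 2^-1 ^+ n.
Proof.
move=> sP.
have tail n p : nrm (s (n + p)%N - s n) <= 2 * 2^-1 ^+ n - 2 * 2^-1 ^+ (n + p).
  elim: p => [|p IH]; first by rewrite addn0 !subrr nrm0.
  rewrite addnS (le_trans (nrm_tri (s (n + p)%N) _ _))//.
  rewrite (le_trans (lerD (sP _) IH))// exprS; move: (2^-1 ^+ (n + p)) => x; lra.
have tail' n p : (n <= p)%N -> nrm (s p - s n) <= 2 * 2^-1 ^+ n.
  move=> /subnKC <-; apply: (le_trans (tail _ _)).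
  by rewrite gerBl mulr_ge0.
have [l lP] : exists l, forall e : R, 0 < e -> exists n0, forall n, (n0 <= n)%N ->
    nrm (s n - l) <= e.
  apply: complete_nrm => e e0; have [n nP] := half_pow_small 2 (divr_gt0 e0 (ltr0Sn _ 1)).
  exists n => p q np nq; rewrite (le_trans (nrm_tri (s n) _ _))// [e]splitr.
  have nP' := ltW (nP n (leqnn n)).
  by apply: lerD; [|rewrite nrm_distC]; exact: le_trans (tail' _ _ _) nP'.
exists l => n; apply: le_eps => e e0; have [p pP] := lP e e0.
rewrite (le_trans (nrm_tri (s (maxn n p)) _ _))// lerD//.
  by rewrite nrm_distC tail' ?leq_maxl.
by apply: pP; exact: leq_maxr.
Qed.

Variables (T : V -> E -> F) (z0 : V).
Hypothesis T_linear : forall w a x y, T w (a *: x + y) = a *: T w x + T w y.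

Let TD w x y : T w (x + y) = T w x + T w y.
Proof. by rewrite -[x]scale1r T_linear !scale1r. Qed.
Let T0 w : T w 0 = 0.
Proof. by have /(congr1 (fun t => t - T w 0)) := TD w 0 0; rewrite addr0 addrK subrr => <-. Qed.
Let TZ w a x : T w (a *: x) = a *: T w x.
Proof. by rewrite -[a *: x]addr0 T_linear T0 addr0. Qed.

(* A partial Newton sum [psum], with the product [node] of the linear factors
   vanishing at the interpolation points already used, and a radius [rad]
   below which no interpolation point lies. *)
Record newton := Newton { node : V -> R[i]^o; psum : V -> E; rad : R }.

(** The upper bound on [node S] makes the series converge on the ball of radius [1 / 2]; the lower
    bound on the smaller ball lets the next term have an effect at the next point. *)
Definition newton_inv (S : newton) := 
  [/\ forall w, differentiable (node S) w, forall w, differentiable (psum S) w,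
      0 < rad S <= 1 / 2, forall h, nrm h <= 1 / 2 -> nrm (node S (z0 + h)) <= 1 &
      exists2 c : R, 0 < c & forall h, nrm h < rad S -> c <= nrm (node S (z0 + h))].

Definition newton_step n (S S' : newton) := exists (h : V) (x : E) (g : V -> R[i]),
  [/\ nrm h < rad S, rad S' <= rad S / 2, nrm x <= 2^-1 ^+ n &
   [/\ forall w, node S' w = node S w * g w, g (z0 + h) = 0,
       forall w, psum S' w = psum S w + node S w *: x &
       n%:R <= nrm (T (z0 + h) (psum S' (z0 + h)))]].

Lemma newton_next n S :
  (forall r M : R, 0 < r -> 0 <= M ->
    exists h x, 0 < nrm h < r /\ M * nrm x < nrm (T (z0 + h) x)) ->
  newton_inv S -> exists S', newton_inv S' /\ newton_step n S S'.
Proof.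
move=> nB [dp ds /andP[r0 r12] p1 [c c0 cP]].
(* Scaling [x] to norm [2^-1 ^+ n] and multiplying it by a node value of size at least [c] loses at
   most this factor relative to the target [n]. *)
have M0 : 0 <= n%:R / c / 2^-1 ^+ n.
  by rewrite !divr_ge0 ?exprn_ge0// ltW.
have [h [x [/andP[h0 hr] hx]]] := nB (rad S) _ r0 M0.
have e0 : 0 < 2^-1 ^+ n :> R by rewrite exprn_gt0.
have x0 : 0 < nrm x.
  rewrite nrm_gt0; apply/eqP => xE; move: hx.
  by rewrite xE T0 !nrm0 mulr0 ltxx.
pose y := (2^-1 ^+ n / nrm x)%:C%C *: x.
have ny : nrm y = 2^-1 ^+ n.
  by rewrite nrmZ nrmC ger0_norm ?divr_ge0 ?nrm_ge0 ?ltW// divfK// gt_eqF.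
have nTy : n%:R <= nrm (T (z0 + h) (node S (z0 + h) *: y)).
  rewrite TZ nrmZ /y TZ nrmZ nrmC ger0_norm ?divr_ge0 ?nrm_ge0 ?(ltW e0)//.
  rewrite (@le_trans _ _ (c * (2^-1 ^+ n / nrm x * (n%:R / c / 2^-1 ^+ n * nrm x))))//.
    rewrite le_eqVlt; apply/orP; left; apply/eqP; field.
    by rewrite !gt_eqF.
  apply: ler_pM; rewrite ?(ltW c0) ?cP//.
    by rewrite !mulr_ge0 ?invr_ge0 ?nrm_ge0 ?(ltW e0)// ltW.
  by rewrite ler_wpM2l ?divr_ge0 ?nrm_ge0 ?(ltW e0)// ltW.
have [y' [ny' nTy']] : exists y', nrm y' = 2^-1 ^+ n /\
    n%:R <= nrm (T (z0 + h) (psum S (z0 + h) + node S (z0 + h) *: y')).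
  have [nT|nT] := nrm_sign (T (z0 + h) (psum S (z0 + h))) nTy.
    by exists y; rewrite ny TD.
  exists (- y); rewrite nrmN ny; split=> //.
  by rewrite TD scalerN -scaleN1r TZ scaleN1r.
(* A coordinate realizing the norm of [h] gives the new linear factor: it is at most [1] on the ball
   of radius [1 / 2], and at least [nrm h / 2] on the ball of radius [nrm h / 2]. *)
have [k hk] : exists k, nrm (coordinate k h) = nrm h.
  by apply: nrm_coord_max; rewrite -nrm_gt0.
pose g (w : V) : R[i] := coordinate k w - coordinate k (z0 + h).
have gE u : g (z0 + u) = coordinate k u - coordinate k h.
  by rewrite /g !coordD opprD addrACA subrr add0r.
exists (Newton (fun w => node S w * g w) (fun w => psum S w + node S w *: y') (nrm h / 2)).
split; last first.
  exists h, y', g; split=> //=; first by rewrite ler_pM2r// ltW.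
    by rewrite ny'.
  by split=> //; rewrite gE subrr.
split=> /=.
- move=> w; apply: (@differentiable_scale R V R[i]^o (node S) g); first exact: dp.
  apply: differentiableB; last exact: differentiable_cst.
  exact: coord_differentiable.
- move=> w; apply: differentiableD; first exact: ds.
  apply: (@differentiable_scale R V E (node S) (fun=> y')); first exact: dp.
  exact: differentiable_cst.
- by move: h0 hr r12; lra.
- move=> u u12; rewrite nrmM mulr_ile1 ?nrm_ge0 ?p1// gE.
  rewrite (le_trans (nrmB _ _))// hk (le_trans (lerD (nrm_coord _ _) (lexx _)))//.
  by move: u12 hr r12; lra.
exists (c * (nrm h / 2)) => [|u uh]; first by rewrite mulr_gt0// divr_gt0.
rewrite nrmM ler_pM ?(ltW c0) ?divr_ge0 ?nrm_ge0//.
  by apply: cP; move: uh hr h0; lra.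
rewrite gE nrm_distC.
have : nrm (coordinate k h) <= nrm (coordinate k h - coordinate k u) + nrm (coordinate k u).
  by rewrite -{1}(subrK (coordinate k u) (coordinate k h)) nrmD.
by rewrite hk; have := nrm_coord k u; move: uh; lra.
Qed.

Lemma punctured_bound :
  (forall f : V -> E, (\forall w \near z0, differentiable f w) ->
    exists r K : R, 0 < r /\ on_ball z0 r (fun w => nrm (T w (f w)) <= K)) ->
  exists r M : R, [/\ 0 < r, 0 <= M &
    forall h x, 0 < nrm h < r -> nrm (T (z0 + h) x) <= M * nrm x].
Proof.
move=> Tb; apply: contrapT => nB0.
have nB (r M : R) : 0 < r -> 0 <= M ->
    exists h x, 0 < nrm h < r /\ M * nrm x < nrm (T (z0 + h) x).
  move=> r0 M0; apply: contrapT => nhx; apply: nB0; exists r, M; split=> // h x hr.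
  by rewrite leNgt; apply/negP => hM; apply: nhx; exists h, x.
have /choice[nx nxP] (nS : nat * newton) : exists S',
    newton_inv nS.2 -> newton_inv S' /\ newton_step nS.1 nS.2 S'.
  have [iS|niS] := pselect (newton_inv nS.2); last by exists nS.2.
  by have [S' S'P] := newton_next nS.1 nB iS; exists S'.
pose Sq := fix Sq n := if n is p.+1 then nx (p, Sq p)
  else Newton (fun=> 1) (fun=> 0) (1 / 2).
have iS n : newton_inv (Sq n).
  elim: n => [|n IH]; last by case: (nxP (n, Sq n) IH).
  split=> /=; try (by move=> w; exact: differentiable_cst).
  - by rewrite lexx andbT; lra.
  - by move=> h _; rewrite nrm1.
  - by exists 1 => // h _; rewrite nrm1.
have step n : newton_step n (Sq n) (Sq n.+1) by case: (nxP (n, Sq n) (iS n)).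
have [h hP] := choice step.
have rad_small n : rad (Sq n) <= 2^-1 ^+ n.
  elim: n => [|n IH]; first by rewrite /= expr0; lra.
  have [x [g [_ r2 _ _]]] := hP n.
  by rewrite (le_trans r2)// exprSr ler_pM2r.
have h_small n : nrm (h n) < 2^-1 ^+ n.
  by have [x [g [hr _ _ _]]] := hP n; exact: lt_le_trans hr (rad_small n).
have h_half n : nrm (h n) <= 1 / 2.
  have [x [g [hr _ _ _]]] := hP n; have [_ _ /andP[_ r12] _ _] := iS n.
  exact: ltW (lt_le_trans hr r12).
have incr u n : nrm u <= 1 / 2 ->
    nrm (psum (Sq n.+1) (z0 + u) - psum (Sq n) (z0 + u)) <= 2^-1 ^+ n.
  move=> u12; have [x [g [_ _ xn [_ _ psE _]]]] := hP n.
  rewrite psE [X in nrm (X - _)]addrC addrK nrmZ (le_trans _ xn)// ler_piMl ?nrm_ge0//.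
  by have [_ _ _ p1 _] := iS n; exact: p1.
(* The limit, as a function of the displacement from [z0]; its values beyond radius [1 / 2] are
   arbitrary. *)
have /choice[e0 e0P] u : exists l, nrm u <= 1 / 2 ->
    forall n, nrm (psum (Sq n) (z0 + u) - l) <= 2 * 2^-1 ^+ n.
  have [u12|nu] := pselect (nrm u <= 1 / 2); last by exists 0.
  have [l lP] := telescope_bound (fun n => incr u n u12).
  by exists l.
pose f w := e0 (w - z0).
have fE u : f (z0 + u) = e0 u by rewrite /f addrC addKr.
have df : \forall w \near z0, differentiable f w.
  apply/nrm_nearP; exists (1 / 2) => [|u u12]; first lra.
  have r0 : 0 < 1 / 2 - nrm u by rewrite subr_gt0.
  have inside k : nrm k < 1 / 2 - nrm u -> nrm (u + k) <= 1 / 2.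
    by rewrite ltrBrDl => /(le_lt_trans (nrmD _ _))/ltW.
  apply: (@uniform_limit_differentiable _ _ _ _ (z0 + u) (1 / 2 - nrm u) 2) => //.
    move=> k /inside kr; rewrite -addrA fE; have := e0P _ kr 0%N.
    by rewrite /= sub0r nrmN expr0 mulr1.
  move=> e epos; have [n nP] := half_pow_small 2 epos.
  exists (psum (Sq n)) => k /inside kr; first by have [_ ds _ _ _] := iS n; exact: ds.
  by rewrite -addrA fE nrm_distC (le_trans (e0P _ kr n))// ltW// nP.
(* Once [z0 + h n] has been used, every later node vanishes there, so the partial sums keep their
   value at this point. *)
have later n j : (n < j)%N -> node (Sq j) (z0 + h n) = 0 /\
    psum (Sq j) (z0 + h n) = psum (Sq n.+1) (z0 + h n).
  elim: j => [//|j IH]; rewrite ltnS leq_eqVlt => /predU1P[<-|nj].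
    by have [x [g [_ _ _ [nE gE _ _]]]] := hP n; rewrite nE gE mulr0.
  have [p0 sE] := IH nj; have [x [g [_ _ _ [nE _ psE _]]]] := hP j.
  by rewrite nE psE p0 mul0r scale0r addr0.
have fh n : f (z0 + h n) = psum (Sq n.+1) (z0 + h n).
  rewrite fE; apply/esym/subr0_eq/nrm_le0/le_eps => e epos; rewrite add0r.
  have [p pP] := half_pow_small 2 epos.
  have [_ <-] := later n (maxn n.+1 p) (leq_maxl _ _).
  by rewrite (le_trans (e0P _ (h_half n) _))// ltW// pP// leq_maxr.
have [r [K [r0 fK]]] := Tb f df.
(* This index puts [z0 + h n] in the ball where [K] is a bound, while the value there has norm at
   least [n], which exceeds [K]. *)
have [n1 n1P] := half_pow_small 1 r0; pose n := maxn n1 (Num.bound `|K|).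
have hn : nrm (h n) < r.
  by rewrite (lt_trans (h_small n))// -[_ ^+ _]mul1r n1P// leq_maxl.
have := fK _ hn; rewrite fh; have [x [g [_ _ _ [_ _ _ nT]]]] := hP n.
move=> /(le_trans nT) nK.
have : `|K| < n%:R.
  by rewrite (lt_le_trans (archi_boundP _))// ler_nat leq_maxr.
by rewrite ltNge (le_trans nK)// ler_norm.
Qed.

End NewtonSeries.

(** * Homomorphisms of plain sheaves *)

Section EtaleSections.
Context {R : realType} {V : normedModType R[i]} (Omega : set V).

Lemma open_sheet (E : normedModType R[i]) (s : set V * (V -> E)) :
  local_section s -> open (sheet s : set (etale Omega E)).
Proof.
move=> ls; exists [set s]; first by move=> _ ->.
by rewrite bigcup_set1.
Qed.

Lemma nbhs_sheet (E : normedModType R[i]) (p : etale Omega E) (A : set (etale Omega E)) :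
  nbhs p A -> exists s, [/\ local_section s, sheet s p & sheet s `<=` A].
Proof.
rewrite nbhsE => -[B [[D' D'D <-] [s D's sp]] BA].
exists s; split=> //; first exact: D'D.
by move=> q sq; apply: BA; exists s.
Qed.

Lemma near_near (z : V) (P : V -> Prop) : (\forall w \near z, P w) ->
  \forall w \near z, \forall v \near w, P v.
Proof.
move=> /nrm_nearP[d d0 dP]; apply/nrm_nearP; exists (d / 2) => [|h hd]; first lra.
apply/nrm_nearP; exists (d / 2) => [|k kd]; first lra.
by rewrite -addrA; apply: dP; rewrite (le_lt_trans (nrmD _ _))//; lra.
Qed.

Lemma near_eq_differentiable (F : normedModType R[i]) (f g : V -> F) (z : V) :
  (\forall w \near z, f w = g w) -> differentiable g z -> differentiable f z.
Proof.
move=> /nrm_nearP[d d0 dP] dg; have [K _ KP] := diff_bounded dg.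
apply: (deriv_differentiable (L := 'd g z) _ KP); first exact: linearP.
move=> e e0; have [c c0 cP] := differentiable_deriv dg e0.
exists (Num.min d c) => [|h]; first by rewrite lt_min d0.
rewrite lt_min => /andP[hd hc]; rewrite (dP h hd).
have -> : f z = g z by have := dP 0; rewrite addr0 nrm0; apply.
exact: cP.
Qed.

Variables E F : normedModType R[i].

(** Continuity of [phi] between etale spaces enters here: the preimage of a sheet through the image
    germ contains a sheet through the germ of [f], so one holomorphic [g] represents the images in
    all nearby stalks. *)
Lemma sheaf_hom_section (phi : sheaf_hom Omega E F) (z : Omega) (f : V -> E) :
  (\forall w \near val z, differentiable f w) ->
  exists2 g : V -> F, \forall w \near val z, differentiable g w &
    \forall w \near val z, forall v : Omega, val v = w ->
      phi v (germ_of (val v) f) = germ_of (val v) g.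
Proof.
move=> df; pose p : etale Omega E := Etale (germ_of (val z) f).
pose q : etale Omega F := Etale (phi z (germ_of (val z) f)).
pose g := germ_repr (stalk_germ q); exists g; first exact: germ_repr_holo.
have gq : nbhs (val z) [set w | differentiable g w] by exact: germ_repr_holo.
have [U [oU Uz] hU] : exists2 U, open_nbhs (val z) U & U `<=` [set w | differentiable g w].
  by move: gq; rewrite nbhsE.
have lU : local_section (U, g) by split.
have nq : nbhs q (sheet (U, g)).
  apply: open_nbhs_nbhs; split; first exact: open_sheet.
  by split => //=; rewrite germ_reprK.
have np : nbhs p [set r | sheet (U, g) (Etale (phi (base r) (stalk_germ r)))].
  exact: (@stalk_hom_continuous _ _ _ _ _ phi p _ nq).
have [[W f'] [lW [/= Wz pE] Wsub]] := nbhs_sheet np.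
have [/= oW hW] := lW.
have nW : \forall w \near val z, W w by exact: open_nbhs_nbhs.
(* Equality of germs at [val z] means equality on a neighborhood, hence equality of germs at all
   nearby points. *)
have /near_near nff' := (eq_germ_of df (open_holomorphic oW Wz hW)).1 pE.
near=> w => v vw; have Ww : W w by near: w.
have fw : \forall u \near w, f u = f' u by near: w.
have [//|/= Uv <-] := Wsub (Etale (germ_of (val v) f)).
split=> /=; first by rewrite vw.
apply/eq_germ_of; rewrite vw //.
- by near: w; exact: near_near.
- exact: open_holomorphic oW Ww hW.
Unshelve. all: by end_near. Qed.

End EtaleSections.

(** * Operations on germs and evaluation at the base point *)

Section GermAlgebra.
Context {R : realType} {V E : normedModType R[i]} (z : V).
Implicit Types (f g : V -> E) (a : V -> R[i]^o).

Lemma germ_ofD f g : (\forall w \near z, differentiable f w) ->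
  (\forall w \near z, differentiable g w) ->
  germ_of z (fun w => f w + g w) = germ_of z f + germ_of z g.
Proof.
move=> df dg; have dfg : \forall w \near z, differentiable (fun w => f w + g w) w.
  by apply: filterS2 df dg => w; exact: differentiableD.
apply: eq_germ; have H1 := germ_ofK dfg; have H2 := germ_ofK df; have H3 := germ_ofK dg.
have H4 := germ_reprD (germ_of z f) (germ_of z g); near=> w.
rewrite (near H1 w)//; apply: esym; apply: etrans (near H4 w _) _ => //.
by rewrite (near H2 w)// (near H3 w).
Unshelve. all: by end_near. Qed.

Lemma germ_ofZ a f : (\forall w \near z, differentiable a w) ->
  (\forall w \near z, differentiable f w) ->
  germ_of z (fun w => (a w : R[i]) *: f w) = (germ_of z a : germ_ring z) *: germ_of z f.
Proof.
move=> da df; have daf : \forall w \near z, differentiable (fun w => (a w : R[i]) *: f w) w.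
  by apply: filterS2 da df => w; exact: differentiable_scale.
apply: eq_germ; have H1 := germ_ofK daf; have H2 := germ_ofK da; have H3 := germ_ofK df.
have H4 := germ_reprZ (germ_of z a : germ_ring z) (germ_of z f); near=> w.
rewrite (near H1 w)//; apply: esym; apply: etrans (near H4 w _) _ => //.
by rewrite (near H2 w)// (near H3 w).
Unshelve. all: by end_near. Qed.

Definition germ_value (g : germ E z) : E := germ_repr g z.

Lemma germ_value_of f : (\forall w \near z, differentiable f w) ->
  germ_value (germ_of z f) = f z.
Proof. by move=> df; exact: nbhs_singleton (germ_ofK df). Qed.

Lemma germ_valueD (g h : germ E z) : germ_value (g + h) = germ_value g + germ_value h.
Proof. exact: nbhs_singleton (germ_reprD g h). Qed.

Lemma germ_valueZ (a : germ_ring z) (g : germ E z) :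
  germ_value (a *: g) = (germ_repr a z : R[i]) *: germ_value g.
Proof. exact: nbhs_singleton (germ_reprZ a g). Qed.

End GermAlgebra.

(** * The fibre maps of a sheaf homomorphism *)

Section PlainHom.
Context {R : realType} {m : nat} {Omega : set (Cn R m)} {E F : completeNormedModType R[i]}.
Variable phi : sheaf_hom Omega E F.
Local Notation V := (Cn R m).

Definition point (w : V) (Ow : Omega w) : Omega := SigSub (mem_set Ow).

(* Set to [0] off [Omega], so that it is linear in [x] for every [w]. *)
Definition fiber_map (w : V) (x : E) : F :=
  if pselect (Omega w) is left Ow then
    germ_value (phi (point Ow) (germ_of w (cst x))) else 0.

Lemma fiber_mapE (w : Omega) x :
  fiber_map (val w) x = germ_value (phi w (germ_of (val w) (cst x))).
Proof.
case: w => w wO /=; rewrite /fiber_map; case: pselect => [Ow|nO].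
  by rewrite (bool_irrelevance wO (mem_set Ow)).
by case: nO; exact: set_mem wO.
Qed.

Lemma near_cst (W : normedModType R[i]) (z : V) (x : W) :
  \forall w \near z, differentiable (cst x : V -> W) w.
Proof. by near=> w; exact: differentiable_cst. Unshelve. all: by end_near. Qed.

(** A complex scalar acts as the germ of a constant function, so linearity over the ring of germs
    suffices. *)
Lemma fiber_map_linear w a x y :
  fiber_map w (a *: x + y) = a *: fiber_map w x + fiber_map w y.
Proof.
rewrite /fiber_map; case: pselect => [Ow|_]; last by rewrite scaler0 addr0.
set p := point Ow.
have -> : germ_of w (cst (a *: x + y) : V -> E) =
    (germ_of w (cst a : V -> R[i]^o) : germ_ring w) *: germ_of w (cst x) + germ_of w (cst y).
  rewrite -(germ_ofZ (near_cst w (a : R[i]^o)) (near_cst w x)) -germ_ofD //.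
    exact: (near_cst w (a *: x)).
  exact: near_cst.
have -> : phi p ((germ_of w (cst a : V -> R[i]^o) : germ_ring w) *: germ_of w (cst x) + germ_of w (cst y))
  = (germ_of w (cst a : V -> R[i]^o) : germ_ring w) *: phi p (germ_of w (cst x)) + phi p (germ_of w (cst y)).
  exact: linearP.
rewrite germ_valueD germ_valueZ; congr (_ *: _ + _).
exact: (germ_value_of (near_cst w (a : R[i]^o))).
Qed.

Lemma germ_of_sum (z : V) n (f : 'I_n -> V -> E) :
  (forall i, \forall w \near z, differentiable (f i) w) ->
  (\forall w \near z, differentiable (fun w => \sum_i f i w) w) /\
  germ_of z (fun w => \sum_i f i w) = \sum_i germ_of z (f i).
Proof.
elim: n f => [|n IH] f df.
  have -> : (fun w => \sum_(i < 0) f i w) = cst 0 by apply/funext => w; rewrite big_ord0.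
  by split; [exact: near_cst|rewrite big_ord0].
have -> : (fun w => \sum_i f i w) =
    (fun w => f ord0 w + \sum_(i < n) f (lift ord0 i) w).
  by apply/funext => w; rewrite big_ord_recl.
have [d1 e1] := IH (fun i => f (lift ord0 i)) (fun i => df _).
split; first by apply: filterS2 (df ord0) d1 => w; exact: differentiableD.
by rewrite big_ord_recl -e1; apply: germ_ofD.
Qed.

(* By Hadamard's lemma [f - f z] lies in the maximal ideal times the stalk. *)
Lemma germ_value_hom (z : Omega) (f : V -> E) :
  (\forall w \near val z, differentiable f w) ->
  germ_value (phi z (germ_of (val z) f)) = fiber_map (val z) (f (val z)).
Proof.
move=> df; have [r [q [r0 dq fE]]] := hadamard df.
pose l i : V -> R[i]^o := fun w => coordinate i w - coordinate i (val z).
have dl i : \forall w \near val z, differentiable (l i) w.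
  near=> w; apply: differentiableB; last exact: differentiable_cst.
  exact: coord_differentiable.
have dq' i : \forall w \near val z, differentiable (q i) w.
  by apply/nrm_nearP; exists r => // h /(dq i h).
have dlq i : \forall w \near val z, differentiable (fun w => (l i w : R[i]) *: q i w) w.
  by apply: filterS2 (dl i) (dq' i) => w; exact: differentiable_scale.
have [ds gs] := germ_of_sum dlq.
have -> : germ_of (val z) f = germ_of (val z) (cst (f (val z))) +
    \sum_i (germ_of (val z) (l i) : germ_ring (val z)) *: germ_of (val z) (q i).
  have -> : \sum_i (germ_of (val z) (l i) : germ_ring (val z)) *: germ_of (val z) (q i) =
      \sum_i germ_of (val z) (fun w => (l i w : R[i]) *: q i w).
    by apply: eq_bigr => i _; exact/esym/germ_ofZ.
  rewrite -gs -germ_ofD //; last exact: near_cst.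
  apply/eq_germ_of => //.
    by apply: filterS2 (near_cst (val z) (f (val z))) ds => w; exact: differentiableD.
  apply/nrm_nearP; exists r => // h /fE ->; congr (_ + _).
  apply: eq_bigr => i _; congr (_ *: _).
  by rewrite /l coordD [_ + coordinate i h]addrC addrK.
rewrite [X in germ_value X]linearD germ_valueD -fiber_mapE.
rewrite [X in _ + germ_value X]linear_sum.
(* By linearity over germs, each coefficient [l i] can be taken out of [phi], and it vanishes at
   [val z]. *)
have -> : germ_value (\sum_i phi z ((germ_of (val z) (l i) : germ_ring (val z)) *: germ_of (val z) (q i))) = 0.
  elim/big_ind : _ => [|a b a0 b0|i _].
  - exact: (germ_value_of (near_cst (val z) (0 : F))).
  - by rewrite germ_valueD a0 b0 addr0.
  - rewrite linearZ germ_valueZ.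
    have -> : germ_repr (germ_of (val z) (l i) : germ_ring (val z)) (val z) = 0.
      by apply: etrans (germ_value_of (dl i)) _; rewrite /l subrr.
    by rewrite scale0r.
by rewrite addr0.
Unshelve. all: by end_near. Qed.

Hypothesis openOmega : open Omega.

(** Openness of [Omega] puts all nearby points in [Omega], where the value of the image germ can be
    compared with [fiber_map]. *)
Lemma hom_section (z : Omega) (f : V -> E) :
  (\forall w \near val z, differentiable f w) ->
  exists g : V -> F, [/\ \forall w \near val z, differentiable g w,
    phi z (germ_of (val z) f) = germ_of (val z) g &
    \forall w \near val z, fiber_map w (f w) = g w].
Proof.
move=> df; have [g dg gE] := sheaf_hom_section phi df.
exists g; split=> //; first exact: (nbhs_singleton gE).
have nO : \forall w \near val z, Omega w.
  by apply: open_nbhs_nbhs; split=> //; exact: set_mem (valP z).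
have df' := near_near df; have dg' := near_near dg.
near=> w; have Ow : Omega w by near: w.
have H : forall v : Omega, val v = w -> phi v (germ_of (val v) f) = germ_of (val v) g.
  by near: w.
have dfw : \forall v \near w, differentiable f v by near: w.
have dgw : \forall v \near w, differentiable g v by near: w.
have E1 := germ_value_hom (z := point Ow) dfw.
by rewrite -[LHS]E1 (H (point Ow) erefl) (germ_value_of dgw).
Unshelve. all: by end_near. Qed.

Lemma fiber_map_differentiable (z : Omega) x :
  \forall w \near val z, differentiable (fun w => fiber_map w x) w.
Proof.
have [g [dg _ gE]] := hom_section (near_cst (val z) x).
have gE' := near_near gE; near=> w.
by apply: (@near_eq_differentiable _ _ _ _ g); near: w.
Unshelve. all: by end_near. Qed.

Lemma fiber_map_bounded (z : Omega) : (0 < m)%N ->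
  exists r M : R, [/\ 0 < r, 0 <= M &
    forall h x, nrm h < r -> nrm (fiber_map (val z + h) x) <= M * nrm x].
Proof.
move=> m_gt0; have [f df|r [M [r0 M0 HM]]] :=
    @punctured_bound R m E F fiber_map (val z) fiber_map_linear.
  have [g [dg _ gE]] := hom_section df.
  have [r [K [r0 _ gK]]] := differentiable_bounded dg.
  move: gE => /nrm_nearP[d d0 dE]; exists (Num.min r d), K; split; first by rewrite lt_min r0.
  by move=> h; rewrite lt_min => /andP[/gK hK /dE ->].
exists r, M; split=> // h x hr; have [->|h0] := eqVneq h 0; last first.
  by apply: HM; rewrite nrm_gt0 h0.
rewrite addr0; apply: le_eps => e e0.
have dz : differentiable (fun w => fiber_map w x) (val z).
  exact: nbhs_singleton (fiber_map_differentiable z x).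
have [K _ KP] := diff_bounded dz.
have [d d0 dP] := deriv_at_continuous KP (differentiable_deriv dz) e0.
(* A nonzero displacement, available because [m] is positive: the punctured bound holds at
   [val z + k], and continuity for the fixed [x] carries it to the centre at the cost of [e]. *)
pose k : V := ((Num.min d r / 2)%:C%C *: (const_mx 1 : 'rV[R[i]]_m)) : V.
pose i0 := Ordinal m_gt0.
have k1 : nrm (const_mx 1 : V) = 1.
  have n0 : (const_mx 1 : V) != 0.
    apply/eqP => /(congr1 (coordinate i0)); rewrite /coordinate !mxE => /eqP.
    by rewrite oner_eq0.
  by have [i <-] := nrm_coord_max n0; rewrite /coordinate mxE nrm1.
have md0 : 0 < Num.min d r by rewrite lt_min d0.
have nk : nrm k = Num.min d r / 2.
  by rewrite [LHS]nrmZ k1 mulr1 nrmC ger0_norm// divr_ge0// ltW.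
have kd : nrm k < d /\ nrm k < r.
  have : nrm k < Num.min d r by rewrite nk; lra.
  by rewrite lt_min => /andP[].
have k0 : 0 < nrm k by rewrite nk divr_gt0.
have := dP k kd.1; have := HM k x; rewrite k0 kd.2 => /(_ isT) H1 H2.
rewrite -[fiber_map (val z) x](subKr (fiber_map (val z + k) x)).
by rewrite (le_trans (nrmB _ _))// lerD.
Qed.

(** For positive [m], [fiber_homE] shows that the default of [insubd] is never reached on
    [Omega]. *)
Definition fiber_hom (w : V) : Defs.Hom E F := insubd 0 (fiber_map w).

Lemma fiber_homE (z : Omega) : (0 < m)%N -> fiber_hom (val z) = fiber_map (val z) :> (E -> F).
Proof.
move=> m_gt0; rewrite /fiber_hom /Hom_fun insubdK//.
have [r [M [r0 M0 HM]]] := fiber_map_bounded z m_gt0.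
apply/asboolP; split; first by move=> a x y; exact: fiber_map_linear.
pose l : {linear E -> F} := HB.pack (fiber_map (val z))
  (GRing.isLinear.Build _ _ _ _ (fiber_map (val z)) (fiber_map_linear (val z))).
rewrite -[fiber_map _]/(l : E -> F); apply/linear_bounded_continuous/linear_boundedP.
near=> k => x /=; rewrite (@le_trans _ _ (M%:C%C * `|x|))//.
  rewrite !nrmE -rmorphM lecR.
  by have := HM 0 x; rewrite addr0 nrm0; apply.
rewrite ler_wpM2r//; near: k; apply: nbhs_pinfty_ge.
by apply/complex_realP; eexists.
Unshelve. all: by end_near. Qed.

Lemma fiber_hom_holomorphic : (0 < m)%N -> holomorphic Omega fiber_hom.
Proof.
move=> m_gt0 z Oz; have [r [M [r0 M0 HM]]] := fiber_map_bounded (point Oz) m_gt0.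
have /nrm_nearP[d d0 dO] : \forall w \near z, Omega w.
  by apply: open_nbhs_nbhs.
apply: (@Hom_differentiable _ _ _ _ _ z (Num.min r d) M).
- by rewrite lt_min r0.
- move=> x h; rewrite lt_min => /andP[hr /dO Oh].
  by rewrite (fiber_homE (point Oh) m_gt0) HM.
- move=> x h; rewrite lt_min => /andP[hr /dO Oh].
  apply: (@near_eq_differentiable _ _ _ _ (fun w => fiber_map w x)); last first.
    exact: nbhs_singleton (fiber_map_differentiable (point Oh) x).
  have nO : \forall w \near (z + h), Omega w by apply: open_nbhs_nbhs.
  by apply: filterS nO => w Ow; rewrite (fiber_homE (point Ow) m_gt0).
Qed.

Lemma fiber_hom_induces : (0 < m)%N -> induced_by phi fiber_hom.
Proof.
move=> m_gt0 z U e oU UO Uz he.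
have de := open_holomorphic oU Uz he.
have [g [dg -> gE]] := hom_section de.
have nU : \forall w \near val z, U w by exact: open_nbhs_nbhs.
have eqg : \forall w \near val z, g w = fiber_hom w (e w).
  by apply: filterS2 nU gE => w /UO Ow <-; rewrite (fiber_homE (point Ow) m_gt0).
apply/eq_germ_of => //; apply: filterS2 nU de => w /UO Ow dew.
apply: differentiable_Hom => //; exact: fiber_hom_holomorphic.
Qed.

End PlainHom.

Theorem theorem1p1 (R : realType) (m : nat) (m_gt0 : (0 < m)%N)
    (Omega : set (Cn R m)) (openOmega : open Omega)
    (E F : completeNormedModType R[i]) (phi : sheaf_hom Omega E F) :
  plain phi.
Proof.
exists (fiber_hom phi); first exact: fiber_hom_holomorphic.
exact: fiber_hom_induces.
Qed.
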